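(* Let $X$ be a Dedekind complete (complex) Banach lattice and let $Y$ be an almost localized subspace of $X$. Let $A$ and $U$ be linear bounded disjointness preserving operators on $X$ such that (1) $U \geq 0$ and $\sigma(U) \subseteq \Gamma$; (2) $A \in Z(X)$; (3) $AUY \subseteq Y$. Let $T = AU$. Then $\sigma_{ap}(T,X) = \sigma_{ap}(T,Y)$.
   Context: All Banach lattices are over $\mathbb{C}$. $\Gamma$ is the unit circle in $\mathbb{C}$. $Z(X)$ is the center of $X$ (all linear operators $A$ on $X$ for which there is $c \geq 0$ with $|Ax| \leq c|x|$ for all $x \in X$). An operator $R$ on $X$ is disjointness preserving if $|x_1| \wedge |x_2| = 0$ implies $|Rx_1| \wedge |Rx_2| = 0$. For a Banach space $W$ invariant under a bounded operator $T$, $\sigma(T,W)$ is the spectrum of $T$ as an operator on $W$ ($\sigma(U) = \sigma(U,X)$); $\sigma_r(T,W) = \{\lambda \in \sigma(T,W) : \exists c>0 \ \|\lambda x - Tx\| \geq c\|x\| \text{ for all } x \in W\}$; $\sigma_{ap}(T,W) = \sigma(T,W) \setminus \sigma_r(T,W)$. A closed subspace $Y$ of a Banach lattice $X$ is almost localized in $X$ if for any nonzero band $Z$ in $X$ and any $\varepsilon > 0$ there is $y \in Y$ such that $\|y\| = 1$ and $\|(I - P_Z)y\|_{\hat{X}} < \varepsilon$, where $P_Z$ is the band projection onto the band $\hat{Z}$ generated by $Z$ in the Dedekind completion $\hat{X}$ of $X$ (if $X$ is Dedekind complete, $\hat{X} = X$ and $P_Z$ is the band projection of $X$ onto $Z$).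 *)

(* Defs.v *)
From HB Require Import structures.
From mathcomp Require Import all_boot all_order all_algebra.
From mathcomp Require Import complex.
From mathcomp Require Import all_classical all_reals all_analysis.
From mathcomp Require Import lra.
Import Order.TTheory GRing.Theory Num.Theory.
Import numFieldNormedType.Exports.

Set Implicit Arguments.
Unset Strict Implicit.
Unset Printing Implicit Defensive.

Local Open Scope classical_set_scope.
Local Open Scope ring_scope.
Local Open Scope complex_scope.

(* Real Banach lattices. The order is part of the mixin rather than inherited
   from [Order.Lattice], because MathComp's hierarchy does not accept a new
   structure joining orders and normed modules next to [realDomainType]; the
   [Order.Lattice] instance is derived just below. The last axiom says that
   |x| <= |y| implies ||x|| <= ||y||, where |x| = x \/ - x. *)
HB.mixin Record isBanachLattice (R : realType) E
    of CompleteNormedModule R E := {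
  vle : rel E ;
  vjoin : E -> E -> E ;
  vle_refl : reflexive vle ;
  vle_anti : antisymmetric vle ;
  vle_trans : transitive vle ;
  vjoinP : forall x y z, vle (vjoin x y) z = vle x z && vle y z ;
  vleD : forall x y z : E, vle x y -> vle (x + z) (y + z) ;
  vle_scale : forall (a : R) (x : E), 0 <= a -> vle 0 x -> vle 0 (a *: x) ;
  vle_norm : forall x y : E,
    vle (vjoin x (- x)) (vjoin y (- y)) -> `|x| <= `|y| }.

#[short(type="banachLatticeType")]
HB.structure Definition BanachLattice (R : realType) :=
  { E of CompleteNormedModule R E & isBanachLattice R E }.

Section order_instance.
Context (R : realType) (E : banachLatticeType R).

HB.instance Definition _ := Order.Le_isPOrder.Build ring_display E
  (@vle_refl R E) (@vle_anti R E) (@vle_trans R E).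

Definition vmeet (x y : E) : E := - vjoin (- x) (- y).

Lemma vleD2r (z x y : E) : (x + z <= y + z) = (x <= y).
Proof.
by apply/idP/idP => [/vleD - /(_ (- z))|/vleD]; [rewrite !addrK|exact].
Qed.

Lemma vsub_ge0 (x y : E) : (0 <= y - x) = (x <= y).
Proof. by rewrite -(vleD2r x 0) add0r subrK. Qed.

Lemma vleN2 (x y : E) : (- x <= - y) = (y <= x).
Proof. by rewrite -(vsub_ge0 (- x)) opprK addrC vsub_ge0. Qed.

Fact le_vmeet (x y z : E) : (x <= vmeet y z) = (x <= y) && (x <= z).
Proof.
rewrite -[x in LHS]opprK vleN2 [_ <= _]vjoinP.
by rewrite -[vle _ _]/(- y <= - x) -[vle (- z) _]/(- z <= - x) !vleN2.
Qed.

HB.instance Definition _ :=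
  Order.POrder_MeetJoin_isLattice.Build ring_display E le_vmeet
    (@vjoinP R E).

Definition vabs (x : E) : E := Order.join x (- x).

Definition dedekind_complete : Prop :=
  forall A : set E, A !=set0 -> has_ubound A -> supremums A !=set0.

End order_instance.
Arguments dedekind_complete {R} E.

Section banach_lattice_facts.
Context (R : realType) (E : banachLatticeType R).
Implicit Types x y z : E.

Lemma vleD2 x y z t : x <= y -> z <= t -> x + z <= y + t.
Proof.
move=> xy zt; apply: (le_trans (_ : _ <= y + z)); first by rewrite vleD2r.
by rewrite !(addrC y) vleD2r.
Qed.

Lemma vaddr_ge0 x y : 0 <= x -> 0 <= y -> 0 <= x + y.
Proof. by move=> x0 y0; rewrite -[leLHS]addr0 vleD2. Qed.

Lemma vscale_ge0 (a : R) x : 0 <= a -> 0 <= x -> 0 <= a *: x.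
Proof. exact: vle_scale. Qed.

Lemma vle_scalel (a : R) x y : 0 <= a -> x <= y -> a *: x <= a *: y.
Proof. by move=> a0 xy; rewrite -vsub_ge0 -scalerBr vscale_ge0 ?vsub_ge0. Qed.

Lemma vle_vabs x : x <= vabs x. Proof. exact: leUl. Qed.

Lemma vleN_vabs x : - x <= vabs x. Proof. exact: leUr. Qed.

Lemma vdouble_ge0 x : 0 <= x + x -> 0 <= x.
Proof.
move=> x0; have -> : x = 2^-1 *: (x + x).
  rewrite scalerDr -scalerDl [X in X *: x](_ : _ = 1) ?scale1r//; lra.
by apply: vscale_ge0 => //; rewrite invr_ge0 ler0n.
Qed.

Lemma vabs_ge0 x : 0 <= vabs x.
Proof.
by apply: vdouble_ge0; rewrite -(subrr x) vleD2 ?vle_vabs ?vleN_vabs.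
Qed.

Lemma vabs_le x y : (vabs x <= y) = (x <= y) && (- x <= y).
Proof. exact: leUx. Qed.

Lemma ger0_vabs x : 0 <= x -> vabs x = x.
Proof.
move=> x0; apply: join_l; apply: (le_trans _ x0).
by rewrite -oppr0 vleN2.
Qed.

Lemma vle_norm_abs x y : vabs x <= vabs y -> `|x| <= `|y|.
Proof. exact: vle_norm. Qed.

Lemma norm_vabs x : `|vabs x| = `|x|.
Proof.
have e : vabs (vabs x) = vabs x by rewrite ger0_vabs ?vabs_ge0.
by apply/eqP; rewrite eq_le !vle_norm_abs ?e.
Qed.

Lemma vle_norm_ge0 x y : 0 <= x -> x <= y -> `|x| <= `|y|.
Proof.
by move=> x0 xy; apply: vle_norm_abs; rewrite !ger0_vabs// (le_trans x0 xy).
Qed.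

Lemma vabs_norm_le x y : vabs x <= y -> `|x| <= `|y|.
Proof.
by move=> xy; rewrite -norm_vabs; apply: vle_norm_ge0 => //; exact: vabs_ge0.
Qed.

Lemma vge0_closed x :
  (forall e : R, 0 < e -> exists2 y, 0 <= y & `|y - x| <= e) -> 0 <= x.
Proof.
move=> h; pose n := Order.join (- x) 0.
have n0 : 0 <= n by exact: leUr.
have ne (e : R) : 0 < e -> `|n| <= e.
  move=> /h[y y0 ye]; apply: le_trans ye; apply: vle_norm_abs; rewrite ger0_vabs//.
  rewrite leUx; apply/andP; split; last exact: vabs_ge0.
  by rewrite (le_trans _ (vle_vabs _))// -vsub_ge0 opprK subrK.
have : n = 0.
  apply/eqP; rewrite -normr_le0; apply/ler_addgt0Pl => e e0.
  by rewrite addr0 ne.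
by move=> n_0; rewrite -oppr0 -[x]opprK vleN2 -n_0; exact: leUl.
Qed.

End banach_lattice_facts.

(* The complexification E + iE, whose elements are the pairs x + iy. *)
Record complexification (R : realType) (E : banachLatticeType R) :=
  Cplx { cre : E ; cim : E }.

Section complexification.
Context (R : realType) (E : banachLatticeType R).
Local Notation X := (complexification E).
Local Notation C := (R[i]).

Let to_pair (z : X) : E * E := (cre z, cim z).
Let of_pair (p : E * E) : X := Cplx p.1 p.2.
Let to_pairK : cancel to_pair of_pair. Proof. by case. Qed.

HB.instance Definition _ := Choice.copy X (can_type to_pairK).

Let cadd (z w : X) : X := Cplx (cre z + cre w) (cim z + cim w).
Let copp (z : X) : X := Cplx (- cre z) (- cim z).
Let cscale (l : C) (z : X) : X :=
  Cplx (complex.Re l *: cre z - complex.Im l *: cim z)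
       (complex.Re l *: cim z + complex.Im l *: cre z).

Fact caddA : associative cadd.
Proof. by move=> z w t; rewrite /cadd/= !addrA. Qed.
Fact caddC : commutative cadd.
Proof. by move=> z w; rewrite /cadd (addrC (cre z)) (addrC (cim z)). Qed.
Fact cadd0 : left_id (Cplx 0 0) cadd.
Proof. by case=> x y; rewrite /cadd/= !add0r. Qed.
Fact caddN : left_inverse (Cplx 0 0) copp cadd.
Proof. by case=> x y; rewrite /cadd/= !addNr. Qed.

HB.instance Definition _ := GRing.isZmodule.Build X caddA caddC cadd0 caddN.

Lemma creD (z w : X) : cre (z + w) = cre z + cre w. Proof. by []. Qed.
Lemma cimD (z w : X) : cim (z + w) = cim z + cim w. Proof. by []. Qed.

Fact cscaleA (a b : C) z : cscale a (cscale b z) = cscale (a * b) z.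
Proof.
case: a b z => [a a'] [b b'] [x y]; congr Cplx => /=;
  rewrite !scalerBr !scalerDr !scalerA !scalerBl !scalerDl ?opprD !addrA;
  by rewrite [LHS]addrAC; congr (_ + _); exact: addrAC.
Qed.
Fact cscale1 : left_id 1 cscale.
Proof. by case=> x y; rewrite /cscale/= !scale1r !scale0r subr0 addr0. Qed.
Fact cscaleDr : right_distributive cscale +%R.
Proof.
by move=> a z w; congr Cplx => /=; rewrite !scalerDr ?opprD addrACA.
Qed.
Fact cscaleDl z : {morph cscale^~ z : a b / a + b}.
Proof.
by case=> [a a'] [b b']; congr Cplx => /=; rewrite !scalerDl ?opprD addrACA.
Qed.

HB.instance Definition _ :=
  GRing.Zmodule_isLmodule.Build C X cscaleA cscale1 cscaleDr cscaleDl.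
End complexification.

Section modulus.
Context (R : realType) (E : banachLatticeType R).
Local Notation X := (complexification E).
Local Notation C := (R[i]).
Implicit Types z w : X.

(* |z| = sup { Re (u z) : u complex, |u| = 1 }, that is, the supremum over t
   of (cos t) x + (sin t) y for z = x + iy. It exists in every Banach lattice:
   see [modulus_supremums]. *)
Definition rotations (z : X) : set E :=
  [set cre (u *: z) | u in [set u : C | `|u| = 1]].
Definition modulus (z : X) : E := supremum 0 (rotations z).

Lemma creZ (u : C) z :
  cre (u *: z) = complex.Re u *: cre z - complex.Im u *: cim z.
Proof. by []. Qed.

Lemma rotations_nonempty z : rotations z !=set0.
Proof. by exists (cre (1 *: z)); exists 1 => //=; rewrite normr1. Qed.

Lemma unit_Re_Im (u : C) : `|u| = 1 ->
  `|complex.Re u| <= 1 /\ `|complex.Im u| <= 1.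
Proof.
case: u => a b; rewrite normc_def => -[] /= ab.
have /(congr1 (fun x => x ^+ 2)) : Num.sqrt (a ^+ 2 + b ^+ 2) = 1 by [].
rewrite sqr_sqrtr ?addr_ge0 ?sqr_ge0// expr1n => e.
have a2 := sqr_ge0 a; have b2 := sqr_ge0 b.
by split; rewrite -(@expr_le1 _ 2)// real_normK ?num_real//; lra.
Qed.

Lemma cre_close (u v : C) z (d : R) :
  `|complex.Re u - complex.Re v| <= d -> `|complex.Im u - complex.Im v| <= d ->
  cre (u *: z) <= cre (v *: z) + d *: (vabs (cre z) + vabs (cim z)).
Proof.
have scale_abs (a : R) (x : E) : `|a| <= d -> a *: x <= d *: vabs x.
  move=> ad; apply: (@le_trans _ _ (`|a| *: vabs x)).
    have [a0|a0] := ger0P a; first by rewrite vle_scalel ?vle_vabs.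
    by rewrite -[a in leLHS]opprK scaleNr -scalerN vle_scalel ?vleN_vabs//; lra.
  by rewrite -vsub_ge0 -scalerBl vscale_ge0 ?vabs_ge0// subr_ge0.
move=> h1 h2; rewrite -vsub_ge0 !creZ scalerDr.
have -> : complex.Re v *: cre z - complex.Im v *: cim z +
    (d *: vabs (cre z) + d *: vabs (cim z)) -
    (complex.Re u *: cre z - complex.Im u *: cim z) =
  (d *: vabs (cre z) - (complex.Re u - complex.Re v) *: cre z) +
  (d *: vabs (cim z) - (complex.Im v - complex.Im u) *: cim z).
  rewrite !scalerBl !opprD !opprK !addrA.
  set a := complex.Re v *: _; set b := complex.Im v *: _.
  set c := complex.Re u *: _; set e := complex.Im u *: _.
  set f := d *: _; set g := d *: _.
  by rewrite [LHS](ACl (3*5*1*4*2*6)).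
by apply: vaddr_ge0; rewrite vsub_ge0 scale_abs// distrC.
Qed.

Lemma foldr_join (x0 : E) (s : seq E) (b : E) :
  (foldr Order.join x0 s <= b) = (x0 <= b) && all (fun x => x <= b) s.
Proof.
by elim: s => [|x s ih] /=; [rewrite andbT | rewrite leUx ih andbCA].
Qed.

Lemma rotations_supremums z : supremums (rotations z) !=set0.
Proof.
pose e := vabs (cre z) + vabs (cim z).
have e0 : 0 <= e by rewrite vaddr_ge0 ?vabs_ge0.
pose N (n : nat) : R := n.+1%:R.
have N0 n : 0 < N n by rewrite ltr0n.
have Ni0 n : 0 <= (N n)^-1 by rewrite invr_ge0 ltW.
pose cell n (i j : nat) : set C := [set u | [/\ `|u| = 1,
  Num.trunc ((complex.Re u + 1) * N n) = i &
  Num.trunc ((complex.Im u + 1) * N n) = j]].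
pose v n i j : C := xget 1 (cell n i j).
have v1 n i j : `|v n i j| = 1.
  by rewrite /v; case: xgetP => [u _ []//|_]; exact: normr1.
pose l n : seq E := [seq cre (v n p.1 p.2 *: z) | p <-
  [seq (i, j) | i <- iota 0 (2 * n.+1).+1, j <- iota 0 (2 * n.+1).+1]].
pose m n : E := foldr Order.join (cre (1 *: z)) (l n).
have m_le n b : ubound (rotations z) b -> m n <= b.
  move=> ub; rewrite foldr_join; apply/andP; split.
    by apply: ub; exists 1 => //=; exact: normr1.
  by apply/allP => _ /mapP[[i j] _ ->]; apply: ub; exists (v n i j) => //=.
have mem_m n x : x \in l n -> x <= m n.
  by move=> xl; have := lexx (m n); rewrite foldr_join => /andP[_ /allP]; exact.
have trunc_close n (a b : R) : `|a| <= 1 -> `|b| <= 1 ->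
    Num.trunc ((a + 1) * N n) = Num.trunc ((b + 1) * N n) ->
    `|a - b| <= (N n)^-1.
  rewrite !ler_norml => /andP[a1 a2] /andP[b1 b2] ab.
  have ha : 0 <= (a + 1) * N n by apply: mulr_ge0; [lra|exact: ltW].
  have hb : 0 <= (b + 1) * N n by apply: mulr_ge0; [lra|exact: ltW].
  have /andP[ta ta'] := truncn_itv ha; have /andP[tb tb'] := truncn_itv hb.
  move: ta ta' tb tb'; rewrite ab; set t := Num.trunc _.
  rewrite -natr1 => ta ta' tb tb'.
  have Ni : N n * (N n)^-1 = 1 by rewrite mulfV ?gt_eqF.
  have Np : 0 < (N n)^-1 by rewrite invr_gt0.
  rewrite -(ler_pM2r (N0 n)) mulNr mulVf ?gt_eqF//.
  rewrite -(ler_pM2r (N0 n) (a - b)) mulVf ?gt_eqF//.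
  by apply/andP; split; lra.
have trunc_lt n (a : R) : `|a| <= 1 ->
    Num.trunc ((a + 1) * N n) \in iota 0 (2 * n.+1).+1.
  rewrite ler_norml => /andP[a1 a2]; rewrite mem_iota/= add0n ltnS.
  have ha : 0 <= (a + 1) * N n by apply: mulr_ge0; [lra|exact: ltW].
  have /andP[ta _] := truncn_itv ha.
  rewrite -(ler_nat R) (le_trans ta)// natrM; apply: ler_wpM2r; [exact: ltW|lra].
have le_m n x : rotations z x -> x <= m n + (N n)^-1 *: e.
  move=> [u /= u1 <-]; have [ua ub] := unit_Re_Im u1.
  set i := Num.trunc ((complex.Re u + 1) * N n).
  set j := Num.trunc ((complex.Im u + 1) * N n).
  have [w1 wi wj] : cell n i j (v n i j).
    by rewrite /v; case: xgetP => [w -> //|/(_ u)/=]; case.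
  have [wa wb] := unit_Re_Im w1.
  apply: (@le_trans _ _ (cre (v n i j *: z) + (N n)^-1 *: e)).
    by apply: cre_close; apply: trunc_close.
  rewrite vleD2r; apply: mem_m; apply/mapP; exists (i, j) => //.
  by apply/allpairsP; exists (i, j); split => //=; exact: trunc_lt.
have m_m n p : m p <= m n + (N n)^-1 *: e.
  by apply: m_le => x; exact: le_m.
have mdist n p : (n <= p)%N -> `|m p - m n| <= (N n)^-1 * `|e|.
  move=> np; rewrite -[(N n)^-1]ger0_norm// -normrZ.
  apply: vabs_norm_le; rewrite vabs_le opprB; apply/andP; split.
    by rewrite -vsub_ge0 opprB addrA -[X in 0 <= X - _]addrC vsub_ge0.
  rewrite -vsub_ge0 opprB addrA -[X in 0 <= X - _]addrC vsub_ge0.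
  apply: (le_trans (m_m p n)); rewrite vleD2 //.
  rewrite -vsub_ge0 -scalerBl vscale_ge0// subr_ge0 lef_pV2 ?posrE//.
  by rewrite ler_nat.
have small (d : R) : 0 < d -> exists n, forall p, (n <= p)%N ->
    (N p)^-1 * `|e| <= d.
  move=> d0; exists (Num.trunc (`|e| / d)) => p np.
  rewrite mulrC ler_pdivrMr// mulrC -ler_pdivrMr//.
  have h : 0 <= `|e| / d by rewrite divr_ge0// ltW.
  have /andP[_ /ltW t] := truncn_itv h.
  by apply: (le_trans t); rewrite ler_nat.
have cm : cvg (m @ \oo).
  apply/cauchy_cvgP/cauchy_exP => d d0.
  have [n hn] := small (d / 2) (divr_gt0 d0 (ltr0Sn _ _)).
  exists (m n); exists n => // p /= np; rewrite -ball_normE/= distrC.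
  apply: (le_lt_trans (mdist _ _ np)); apply: (le_lt_trans (hn _ (leqnn n))).
  lra.
pose M : E := limn m.
have Mclose (d : R) : 0 < d -> exists n, forall p, (n <= p)%N -> `|m p - M| <= d.
  move=> d0; have /cvgrPdist_le /(_ _ d0)[n _ hn] := cm.
  by exists n => p np; rewrite distrC; exact: hn.
exists M; split => [x xS|b ub]; last first.
  rewrite -vsub_ge0; apply: vge0_closed => d /Mclose[n /(_ n (leqnn n)) hn].
  exists (b - m n); first by rewrite vsub_ge0 m_le.
  by rewrite opprB addrC addrA subrK distrC.
rewrite -vsub_ge0; apply: vge0_closed => d d0.
have d2 : 0 < d / 2 by lra.
have [n hn] := Mclose _ d2; have [n' hn'] := small _ d2.
pose k := maxn n n'.
exists (m k + (N k)^-1 *: e - x); first by rewrite vsub_ge0 le_m.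
have -> : m k + (N k)^-1 *: e - x - (M - x) = m k - M + (N k)^-1 *: e.
  by rewrite opprB addrA subrK addrAC.
apply: (le_trans (ler_normD _ _)); rewrite [leRHS](splitr d) lerD//.
  by rewrite hn ?leq_maxl.
by rewrite normrZ ger0_norm// hn' ?leq_maxr.
Qed.

Lemma modulus_supremums z : supremums (rotations z) (modulus z).
Proof.
rewrite /modulus /supremum ifF; last first.
  by apply/negP => /eqP z0; have := rotations_nonempty z; rewrite z0 => -[].
case: xgetP => [m _ //|]; have [m hm] := rotations_supremums z.
by move=> /(_ m).
Qed.

Lemma le_modulus z (u : C) : `|u| = 1 -> cre (u *: z) <= modulus z.
Proof.
by move=> u1; have [+ _] := modulus_supremums z; apply; exists u.
Qed.

Lemma modulus_le z (b : E) :
  (forall u : C, `|u| = 1 -> cre (u *: z) <= b) -> modulus z <= b.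
Proof.
move=> h; have [_] := modulus_supremums z; apply.
by move=> _ [u /= u1 <-]; exact: h.
Qed.

Lemma modulus_ge0 z : 0 <= modulus z.
Proof.
apply: vdouble_ge0; rewrite -(subrr (cre (1 *: z))).
have -> : - cre (1 *: z) = cre ((-1) *: z) by rewrite scaleN1r scale1r.
by rewrite vleD2// le_modulus// ?normrN normr1.
Qed.

Lemma modulusD z w : modulus (z + w) <= modulus z + modulus w.
Proof.
by apply: modulus_le => u u1; rewrite scalerDr creD vleD2// le_modulus.
Qed.

Lemma modulus0 : modulus 0 = 0.
Proof.
apply/eqP; rewrite eq_le modulus_ge0 andbT; apply: modulus_le => u _.
by rewrite scaler0.
Qed.

Lemma modulusZ (l : C) z : modulus (l *: z) = complex.Re `|l| *: modulus z.
Proof.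
have Re_norm (a : C) : 0 <= complex.Re `|a|.
  by have := normr_ge0 a; rewrite lecE => /andP[].
have le (a : C) w : a != 0 -> modulus (a *: w) <= complex.Re `|a| *: modulus w.
  move=> a0; apply: modulus_le => u u1.
  have na0 : `|a| != 0 by rewrite normr_eq0.
  have -> : u *: (a *: w) = `|a| *: ((u * a / `|a|) *: w).
    by rewrite !scalerA [`|a| * _]mulrC divfK.
  have -> (t : X) : cre (`|a| *: t) = complex.Re `|a| *: cre t.
    by rewrite creZ normc_def/= scale0r subr0.
  rewrite vle_scalel// le_modulus// normrM normfV normr_id normrM u1 mul1r.
  by rewrite divff.
have [->|l0] := eqVneq l 0.
  by rewrite scale0r modulus0 normr0/= scale0r.
apply/eqP; rewrite eq_le le//=.
have ln0 : complex.Re `|l| != 0.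
  by rewrite -(inj_eq (@complexI R)) RRe_real ?normr_real// normr_eq0.
have := vle_scalel (Re_norm l) (le l^-1 (l *: z) (invr_neq0 l0)).
rewrite scalerA mulVf// scale1r scalerA normfV.
suff -> : complex.Re `|l| * complex.Re `|l|^-1 = 1 by rewrite scale1r.
have e : `|l| = (complex.Re `|l|)%:C by rewrite RRe_real ?normr_real.
by rewrite [in X in _ * X]e -fmorphV/= mulfV.
Qed.

Lemma modulus_eq0 z : modulus z = 0 -> z = 0.
Proof.
move=> z0; have le0 (u : C) : `|u| = 1 -> cre (u *: z) = 0.
  move=> u1; apply/eqP; rewrite eq_le -{1}z0 le_modulus//=.
  rewrite -vleN2 oppr0 -z0.
  by rewrite -[leLHS]/(cre (- (u *: z))) -scaleNr le_modulus ?normrN.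
have := le0 1 (normr1 _); rewrite scale1r.
have /le0 : `|0 +i* (-1) : C| = 1.
  by rewrite normc_def/= expr0n/= sqrrN expr1n add0r sqrtr1.
rewrite creZ/= scale0r sub0r scaleN1r opprK.
by case: z {z0 le0} => x y/= -> ->.
Qed.

Let cnorm z : C := `|modulus z|%:C.

Fact cnormD z w : cnorm (z + w) <= cnorm z + cnorm w.
Proof.
rewrite /cnorm -rmorphD/= lecR (le_trans _ (ler_normD _ _))//.
by rewrite vle_norm_ge0 ?modulus_ge0 ?modulusD.
Qed.

Fact cnormZ (l : C) z : cnorm (l *: z) = `|l| * cnorm z.
Proof.
rewrite /cnorm modulusZ normrZ rmorphM/= ger0_norm ?RRe_real ?normr_real//.
by have := normr_ge0 l; rewrite lecE => /andP[].
Qed.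

Fact cnorm_eq0 z : cnorm z = 0 -> z = 0.
Proof. by move=> [/normr0_eq0/modulus_eq0]. Qed.

HB.instance Definition _ := Lmodule_isNormed.Build C X cnormD cnormZ cnorm_eq0.

Lemma cnormE z : `|z| = `|modulus z|%:C. Proof. by []. Qed.

End modulus.

Section completeness.
Context (R : realType) (E : banachLatticeType R).
Local Notation X := (complexification E).
Local Notation C := (R[i]).
Implicit Types z w : X.

Lemma norm_cre z : `|cre z|%:C <= `|z|.
Proof.
rewrite cnormE lecR; apply: vabs_norm_le; rewrite vabs_le; apply/andP; split.
  by rewrite -[z in cre z]scale1r le_modulus// normr1.
by rewrite -[- _]/(cre (- z)) -scaleN1r le_modulus// normrN normr1.
Qed.

Lemma norm_cim z : `|cim z|%:C <= `|z|.
Proof.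
have i1 : `|0 +i* 1 : C| = 1.
  by rewrite normc_def/= expr0n/= expr1n add0r sqrtr1.
have -> : `|z| = `|(0 +i* 1 : C) *: z| by rewrite normrZ i1 mul1r.
apply: le_trans (norm_cre _).
by rewrite creZ/= scale0r sub0r scale1r normrN.
Qed.

Lemma norm_le_cre_cim z : `|z| <= (`|cre z| + `|cim z|)%:C.
Proof.
rewrite cnormE lecR -(norm_vabs (cre z)) -(norm_vabs (cim z)).
apply: le_trans (ler_normD _ _); apply: vle_norm_ge0; first exact: modulus_ge0.
apply: modulus_le => u /unit_Re_Im[ua ub].
have := @cre_close R E u 0 z 1; rewrite !subr0 scale1r scale0r.
by rewrite [cre 0 + _]add0r; exact.
Qed.

Fact complexification_complete (F : set_system X) :
  ProperFilter F -> cauchy F -> cvg F.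
Proof.
move=> FF /cauchy_ballP Fc.
have part (p : X -> E) : {morph p : z w / z - w} ->
    (forall z, `|p z|%:C <= `|z|) -> cvg (p @ F).
  move=> pB ple; apply: cauchy_cvg; apply/cauchy_ballP => e e0.
  have /Fc : 0 < e%:C by rewrite ltcR.
  move=> [[A B] /= [FA FB]] AB.
  exists (p @` A, p @` B); first by split; [move: FA|move: FB];
    apply: filterS => z ?; exists z.
  move=> [_ _] /= [[z Az <-] [w Bw <-]].
  have := AB (z, w) (conj Az Bw); rewrite -!ball_normE/= -pB -ltcR.
  exact: le_lt_trans (ple _).
have cx := part (@cre R E) (fun _ _ => erefl) norm_cre.
have cy := part (@cim R E) (fun _ _ => erefl) norm_cim.
apply/cvg_ex; exists (Cplx (lim (@cre R E @ F)) (lim (@cim R E @ F))).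
apply/cvgrPdist_lt => e e0.
have e_real : e = (complex.Re e)%:C by rewrite RRe_real ?gtr0_real.
have r0 : 0 < complex.Re e / 2.
  by rewrite divr_gt0// -ltcR -e_real.
have /cvgrPdist_lt /(_ _ r0) hx := cx; have /cvgrPdist_lt /(_ _ r0) hy := cy.
near=> z; rewrite e_real; apply: (le_lt_trans (norm_le_cre_cim _)).
by rewrite ltcR [ltRHS]splitr ltrD//; near: z.
Unshelve. all: by end_near. Qed.

HB.instance Definition _ :=
  Uniform_isComplete.Build X complexification_complete.

End completeness.

(* Spectra of an operator T on a subspace W of a complex normed space. They are
   meant for W closed and T-invariant, so that T restricts to W. *)
Section spectrum.
Context (R : realType) (V : normedModType R[i]).
Implicit Types (T : V -> V) (W : set V) (l : R[i]).

Definition linear_subspace W : Prop :=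
  W 0 /\ forall (a : R[i]) x y, W x -> W y -> W (a *: x + y).

(* T restricts to a bijection of W onto W whose inverse S is bounded; such an S
   is linear on W as soon as T is, and its values outside W are irrelevant. *)
Definition invertible_on T W : Prop := exists S : V -> V,
  [/\ forall x, W x -> W (S x),
      forall x, W x -> S (T x) = x,
      forall x, W x -> T (S x) = x &
      exists c : R, forall x, W x -> `|S x| <= c%:C * `|x|].

Definition spectrum T W : set R[i] :=
  [set l | ~ invertible_on (fun x => l *: x - T x) W].

Definition spectrum_r T W : set R[i] :=
  [set l | spectrum T W l /\ exists2 c : R, 0 < c &
     forall x, W x -> c%:C * `|x| <= `|l *: x - T x| ].

Definition spectrum_ap T W : set R[i] := spectrum T W `\` spectrum_r T W.

End spectrum.

Section complex_banach_lattice.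
Context (R : realType) (E : banachLatticeType R).
Local Notation X := (complexification E).
Implicit Types (T : X -> X) (Y Z : set X).

Definition cdisjoint (z w : X) : Prop :=
  Order.meet (modulus z) (modulus w) = 0.

Definition disjointness_preserving T : Prop :=
  forall z w, cdisjoint z w -> cdisjoint (T z) (T w).

Definition positive_operator T : Prop :=
  forall x : E, 0 <= x -> exists2 y : E, 0 <= y & T (Cplx x 0) = Cplx y 0.

(* Membership in the center, for linear T. *)
Definition in_center T : Prop :=
  exists2 c : R, 0 <= c & forall z, modulus (T z) <= c *: modulus z.

(* A band is an order ideal closed under the suprema of its sets of real
   elements. *)
Definition band Z : Prop :=
  [/\ linear_subspace Z,
      forall z w, Z w -> modulus z <= modulus w -> Z z &
      forall (A : set E) (s : E), (forall x, A x -> Z (Cplx x 0)) ->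
        supremums A s -> Z (Cplx s 0)].

Definition disjoint_complement Z : set X :=
  [set w | forall z, Z z -> cdisjoint w z].

(* The projection onto Z along its disjoint complement: when E is Dedekind
   complete and Z is a band, z has exactly one component w in Z with z - w in
   the disjoint complement. *)
Definition band_projection Z (z : X) : X :=
  xget 0 [set w | Z w /\ disjoint_complement Z (z - w)].

(* For E Dedekind complete, so that E is its own Dedekind completion and the
   band projections exist on the complexification of E itself. *)
Definition almost_localized Y : Prop :=
  [/\ linear_subspace Y, closed Y &
      forall Z, band Z -> (exists2 z, Z z & z != 0) ->
      forall e : R, 0 < e ->
      exists y, [/\ Y y, `|y| = 1 & `|y - band_projection Z y| < e%:C]].

End complex_banach_lattice.

(* Main.v *)
Require Import Defs.
From HB Require Import structures.
From mathcomp Require Import all_boot all_order all_algebra.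
From mathcomp Require Import complex.
From mathcomp Require Import all_classical all_reals all_analysis.
From mathcomp Require Import lra zify ring.
Import Order.TTheory GRing.Theory Num.Theory.
Import numFieldNormedType.Exports.

Set Implicit Arguments.
Unset Strict Implicit.
Unset Printing Implicit Defensive.

Local Open Scope classical_set_scope.
Local Open Scope ring_scope.

(** A scalar l lies in the approximate point spectrum of T on W exactly when
    l - T is not bounded below on W ([spectrum_apE]).  So the inclusion of the
    spectrum on Y in the spectrum on X is immediate, and the theorem says that
    l - T is bounded below on X as soon as it is bounded below on Y
    ([bounded_below_on_localized]).

    The operator U is the complexification of a real operator which, together
    with its inverse V, is a lattice isomorphism: a disjointness preserving
    positive bijection has a positive inverse.  It moves bands to bands.  The
    spectral hypothesis enters through the powers of U and V, which grow more
    slowly than any exponential ([positive_growth], [real_automorphism]).  For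
    positive operators this needs no analytic functions: positivity of the
    resolvent propagates from large s down to every s > 1, and s y - U y = x
    with y >= 0 forces U^n x <= s^(n+1) y.

    Almost localization says that Y has unit vectors close to any given band,
    so a lower bound for a polynomial expression in T on Y is inherited, up to
    an arbitrarily small error, by some nonzero vector of every nonzero band
    ([localized_bounded_below_on_bands]).  It remains to derive a lower bound
    on X from these vectors.

    Let l = 1, the case l <> 0 being reduced to it by rescaling A.  Write
    T^N = A_N U^N, with A_N central.  For suitable N and k a pointwise
    inequality holds ([modulus_le_defects]): |x| is at most
      (4/c) (|x - T x| + ... + |x - T^(2N) x|) + |x - T^N x|
        + U^N |x| / (4k) + V^N |T^N x| / (4k).
    With k a bound for the norms of U^N and V^N, taking norms makes the last
    two terms harmless and gives the lower bound.  If the inequality fails, the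
    reverse strict inequality holds on a nonzero band, which can be shrunk to a
    band Q such that either Q, U Q, ..., U^(2N) Q are disjoint, or for some
    p <= 2N the bands Q, ..., U^(p-1) Q are disjoint and U^p maps every subband
    of Q to itself ([wandering_or_periodic]).  Both cases are impossible.

    In the periodic case slow growth forces U^p = 1 on Q ([periodic_id]), hence
    T^p is central there and close to 1; then z + T z + ... + T^(p-1) z, a sum
    of disjoint terms, is nearly fixed by T ([no_periodic_band]).  In the
    wandering case |A_N| is at least about 1/k on Q and at most about k on
    U^N Q, so that for z in V^N Q the middle term of the sum of the vectors
    rho^|j - N| T^j z, 0 <= j <= 2N, dominates the two ends; neighbouring
    coefficients being almost equal, T nearly fixes this sum as well
    ([no_wandering_band]).

    Statements such as |A_N| <= b on a band have to be drawn from one vector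
    generating the band.  This is [central_le]: on small enough bands every
    vector is close to a scalar multiple of the generator, by
    [locally_scalar].

    For l = 0 the same tools compare U|x| with |T x|
    ([bounded_below_weighted]). *)

(** * Ordered vector space arithmetic *)

Section riesz.
Context (R : realType) (E : banachLatticeType R).
Implicit Types (x y z f h s u v w : E) (a b : R).

Definition vpos x : E := Order.join x 0.

Lemma vpos_ge0 x : 0 <= vpos x. Proof. exact: leUr. Qed.

Lemma le_vpos x : x <= vpos x. Proof. exact: leUl. Qed.

Lemma vle_subl x y z : (x - y <= z) = (x <= z + y).
Proof. by rewrite -[LHS](vleD2r y) subrK. Qed.

Lemma vle_subr x y z : (x <= y - z) = (x + z <= y).
Proof. by rewrite -[LHS](vleD2r z) subrK. Qed.

Lemma vleDl x y z : (z + x <= z + y) = (x <= y).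
Proof. by rewrite !(addrC z) vleD2r. Qed.

Lemma vle_addl x y : 0 <= y -> x <= y + x.
Proof. by move=> y0; rewrite -[leLHS]add0r vleD2r. Qed.

Lemma vle_subid x y : 0 <= y -> x - y <= x.
Proof. by move=> y0; rewrite vle_subl addrC vle_addl. Qed.

Lemma vscale_le_l a b x : 0 <= x -> a <= b -> a *: x <= b *: x.
Proof. by move=> x0 ab; rewrite -vsub_ge0 -scalerBl vscale_ge0// subr_ge0. Qed.

Lemma vposB x : vpos x - vpos (- x) = x.
Proof.
have h y : vpos (- y) + y <= vpos y.
  rewrite -vle_subr leUx; apply/andP; split.
    by rewrite -vsub_ge0 opprK subrK vpos_ge0.
  by rewrite vsub_ge0 le_vpos.
apply/eqP; rewrite eq_le vle_subl vle_subr; apply/andP; split.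
  by have := h (- x); rewrite opprK -vle_subr opprK addrC.
by rewrite addrC h.
Qed.

Lemma vpos_disjoint x : Order.meet (vpos x) (vpos (- x)) = 0.
Proof.
apply/eqP; rewrite eq_le lexI !vpos_ge0 !andbT; set m := Order.meet _ _.
have : vpos x <= vpos x - m.
  rewrite leUx; apply/andP; split; last by rewrite vsub_ge0 leIl.
  rewrite vle_subr -[X in X + _](vposB x) addrAC vle_subl vleDl.
  exact: leIr.
by rewrite vle_subr -[leRHS]addr0 vleDl.
Qed.

Lemma vabsN x : vabs (- x) = vabs x.
Proof. by rewrite /vabs opprK joinC. Qed.

Lemma vabs_eq0 x : vabs x = 0 -> x = 0.
Proof. by move=> x0; apply/normr0_eq0; rewrite -norm_vabs x0 normr0. Qed.

Lemma vabsD x y : vabs (x + y) <= vabs x + vabs y.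
Proof.
by rewrite vabs_le vleD2 ?vle_vabs// opprD vleD2 ?vleN_vabs.
Qed.

Lemma vabsZ_le a x : vabs (a *: x) <= `|a| *: vabs x.
Proof.
have h (c : R) y : c *: y <= `|c| *: vabs y.
  have [c0|c0] := ger0P c; first by rewrite vle_scalel ?vle_vabs.
  by rewrite -[c in leLHS]opprK scaleNr -scalerN vle_scalel ?vleN_vabs//; lra.
by rewrite vabs_le h -scaleNr -(normrN a) h.
Qed.

Lemma disjoint_le x y h : 0 <= x -> 0 <= h -> x <= y ->
  Order.meet y h = 0 -> Order.meet x h = 0.
Proof.
move=> x0 h0 xy yh; apply/eqP; rewrite eq_le [X in _ && X]lexI x0 h0 andbT.
by rewrite -[leRHS]yh lexI leIr (le_trans _ xy)// leIl.
Qed.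

Lemma disjointD x y h : 0 <= x -> 0 <= y -> 0 <= h ->
  Order.meet x h = 0 -> Order.meet y h = 0 -> Order.meet (x + y) h = 0.
Proof.
move=> x0 y0 h0 xh yh; apply/eqP; rewrite eq_le [X in _ && X]lexI h0 vaddr_ge0//= andbT.
set m := Order.meet _ _.
have mx : m <= x.
  rewrite -(add0r x) -vle_subl -yh lexI vle_subl addrC leIl/=.
  by rewrite vle_subl (le_trans (leIr _ _))// addrC vle_addl.
by rewrite -xh lexI mx leIr.
Qed.

Lemma disjointZ a x h : 0 <= a -> 0 <= x -> 0 <= h ->
  Order.meet x h = 0 -> Order.meet (a *: x) h = 0.
Proof.
move=> a0 x0 h0 xh; apply/eqP; rewrite eq_le [X in _ && X]lexI h0 vscale_ge0//= andbT.
set m := Order.meet _ _.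
have b0 : 0 < a + 1 by lra.
suff : (a + 1)^-1 *: m <= 0.
  move=> /(vle_scalel (ltW b0)); rewrite scaler0 scalerA divff ?scale1r//.
  by rewrite gt_eqF.
have m0 : 0 <= m by rewrite lexI h0 vscale_ge0.
have bi : 0 <= (a + 1)^-1 by rewrite invr_ge0 ltW.
rewrite -xh lexI; apply/andP; split.
  apply: (@le_trans _ _ ((a + 1)^-1 *: ((a + 1) *: x))).
    by rewrite vle_scalel// (le_trans (leIl _ _))// vscale_le_l//; lra.
  by rewrite scalerA mulVf ?scale1r ?gt_eqF.
apply: (@le_trans _ _ (1 *: m)); last by rewrite scale1r leIr.
by rewrite vscale_le_l// invf_le1//; lra.
Qed.

Lemma vle0_arch x y : (forall e : R, 0 < e -> x <= e *: y) -> x <= 0.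
Proof.
move=> h; rewrite -oppr0 -[x]opprK vleN2; apply: vge0_closed => e e0.
have n0 : 0 < `|y| + 1 by rewrite ltr_wpDl.
exists ((e / (`|y| + 1)) *: y - x); first by rewrite vsub_ge0 h// divr_gt0.
rewrite opprK subrK normrZ ger0_norm ?divr_ge0 ?ltW//.
by rewrite -mulrA gtr_pMr// mulrC ltr_pdivrMr// mul1r; lra.
Qed.

Lemma vle0_archn x y : (forall n : nat, n%:R *: x <= y) -> x <= 0.
Proof.
move=> h; apply: (@vle0_arch _ (vabs y)) => e e0.
pose n := (Num.trunc e^-1).+1.
have en : 1 <= n%:R * e.
  rewrite -ler_pdivrMr// mul1r ltW//.
  by have /andP[] := @truncn_itv _ e^-1 (ltW (etrans (invr_gt0 _) e0)).
have n0 : 0 < n%:R :> R by rewrite ltr0n.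
have -> : x = n%:R^-1 *: (n%:R *: x).
  by rewrite scalerA mulVf ?scale1r ?gt_eqF.
apply: (@le_trans _ _ (n%:R^-1 *: vabs y)).
  apply: vle_scalel; first by rewrite invr_ge0 ltW.
  by apply: (le_trans (h _)); exact: vle_vabs.
rewrite vscale_le_l ?vabs_ge0//.
by rewrite -[leLHS]mul1r ler_pdivrMr// mulrC.
Qed.

End riesz.

(** * Band projections *)

Section band_projections.
Context (R : realType) (E : banachLatticeType R).
Implicit Types (x y z f h s u v w : E) (a b : R) (P Q S : {linear E -> E}).

Definition positive P : Prop := forall x, 0 <= x -> 0 <= P x.

Lemma positive_le P x y : positive P -> x <= y -> P x <= P y.
Proof. by move=> hP xy; rewrite -vsub_ge0 -linearB hP// vsub_ge0. Qed.

Lemma positive_vabs P x : positive P -> vabs (P x) <= P (vabs x).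
Proof.
by move=> hP; rewrite vabs_le -linearN !positive_le ?vle_vabs ?vleN_vabs.
Qed.

(** Operators lying between 0 and the identity and equal to their square: in
    this form band projections commute, and they compose, without reference to
    the bands they project onto. *)
Definition bproj P : Prop :=
  (forall x, P (P x) = P x) /\ (forall x, 0 <= x -> 0 <= P x /\ P x <= x).

Definition subproj S P : Prop := forall x, P (S x) = S x.

Definition compl P : {linear E -> E} := idfun \- P.

Lemma complE P x : compl P x = x - P x. Proof. by []. Qed.

Lemma bproj_idem P x : bproj P -> P (P x) = P x.
Proof. by move=> []. Qed.

Lemma bproj_positive P : bproj P -> positive P.
Proof. by move=> [_ h] x /h[]. Qed.

Lemma bproj_le P x y : bproj P -> x <= y -> P x <= P y.
Proof. by move=> /bproj_positive; exact: positive_le. Qed.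

Lemma bproj_ge0 P x : bproj P -> 0 <= x -> 0 <= P x.
Proof. by move=> /bproj_positive h; exact: h. Qed.

Lemma bproj_le_id P x : bproj P -> 0 <= x -> P x <= x.
Proof. by move=> [_ h] /h[]. Qed.

Lemma bproj_compl P : bproj P -> bproj (compl P).
Proof.
move=> hP; split=> [x|x x0]; rewrite !complE.
  by rewrite linearB bproj_idem// subrr subr0.
by rewrite vsub_ge0 bproj_le_id// vle_subid// bproj_ge0.
Qed.

(** P and its complement are both positive, so that
    |x| <= |P x| + |x - P x| <= P|x| + (|x| - P|x|) = |x|
    and the second inequality is an equality term by term. *)
Lemma bproj_vabs P x : bproj P -> vabs (P x) = P (vabs x).
Proof.
move=> hP; apply/eqP; rewrite eq_le positive_vabs ?bproj_positive//=.
have := positive_vabs x (bproj_positive (bproj_compl hP)).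
rewrite !complE => h.
  have := vabsD (P x) (x - P x); rewrite addrC subrK => /le_trans.
  move=> /(_ _ (vleD2 (lexx _) h)).
  by rewrite addrCA -[X in X <= _]addr0 vleDl vsub_ge0.
exact: bproj_positive.
Qed.

Lemma bproj_ideal P x y : bproj P -> vabs x <= y -> P y = 0 -> P x = 0.
Proof.
move=> hP xy y0; apply: vabs_eq0; rewrite bproj_vabs//; apply/eqP.
by rewrite eq_le bproj_ge0 ?vabs_ge0// andbT -y0 bproj_le.
Qed.

(** A band projection lies below the identity, hence leaves the kernel of every
    other one invariant; apply this to P and to its complement. *)
Lemma bproj_comm P Q x : bproj P -> bproj Q -> P (Q x) = Q (P x).
Proof.
move=> hP hQ.
have key S y : bproj S -> S y = 0 -> S (Q y) = 0.
  move=> hS y0; apply: (@bproj_ideal _ _ (vabs y)) => //; last first.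
    by rewrite -bproj_vabs// y0 ger0_vabs.
  by rewrite bproj_vabs// bproj_le_id// vabs_ge0.
have /(key _ _ hP) : P (compl P x) = 0 by rewrite complE linearB/= bproj_idem// subrr.
rewrite complE !linearB => /eqP; rewrite subr_eq0 => /eqP ->.
have := key _ (P x) (bproj_compl hP); rewrite !complE bproj_idem// subrr.
by move=> /(_ erefl)/eqP; rewrite subr_eq0 => /eqP <-.
Qed.

Lemma bproj_comp P Q : bproj P -> bproj Q -> bproj (P \o Q).
Proof.
move=> hP hQ; split => [x|x x0] /=.
  by rewrite -(bproj_comm _ hP hQ) bproj_idem// bproj_idem.
rewrite !bproj_ge0//; split=> //.
by rewrite (le_trans (bproj_le_id _ _))// ?bproj_ge0// bproj_le_id.
Qed.

Lemma subproj_refl P : bproj P -> subproj P P.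
Proof. by move=> hP x; exact: bproj_idem. Qed.

Lemma subproj_trans P Q S : subproj S Q -> subproj Q P -> subproj S P.
Proof. by move=> h k x; rewrite -h k. Qed.

Lemma subproj_r P S x : bproj P -> bproj S -> subproj S P -> S (P x) = S x.
Proof. by move=> hP hS h; rewrite bproj_comm. Qed.

Lemma subproj_comp_right P Q : bproj P -> bproj Q -> subproj (Q \o P) P.
Proof. by move=> hP hQ x /=; rewrite (bproj_comm _ hP hQ) bproj_idem. Qed.

Lemma subproj_comp_left P Q : bproj Q -> subproj (Q \o P) Q.
Proof. by move=> hQ x /=; rewrite bproj_idem. Qed.

End band_projections.

(** * Existence of band projections *)

Section existence.
Context (R : realType) (E : banachLatticeType R).
Hypothesis E_complete : dedekind_complete E.
Implicit Types (x y z f h s u v w : E) (a b : R) (P Q S : {linear E -> E}).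

Definition perp f : set E := [set x | Order.meet (vabs x) f = 0].
Definition biperp f : set E :=
  [set x | forall w, perp f w -> Order.meet (vabs x) (vabs w) = 0].

Lemma perp_linear h a x y : 0 <= h -> perp h x -> perp h y -> perp h (a *: x + y).
Proof.
move=> h0 hx hy.
apply: (@disjoint_le _ _ _ (`|a| *: vabs x + vabs y)) => //.
- exact: vabs_ge0.
- by apply: (le_trans (vabsD _ _)); rewrite vleD2r vabsZ_le.
- by apply: disjointD => //; rewrite ?vscale_ge0 ?vabs_ge0//; apply: disjointZ => //;
    rewrite vabs_ge0.
Qed.

Lemma perp_ge0 f x : 0 <= x -> Order.meet x f = 0 -> perp f x.
Proof. by move=> x0 e; rewrite /perp /= ger0_vabs. Qed.

(** The component s of y orthogonal to f is the supremum of the elements of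
    [0, y] that are orthogonal to f: it is orthogonal to f because each of them
    lies below s minus the meet of s and f, and anything in y - s orthogonal to
    f could be added to s. *)
Lemma riesz_decomposition f y : 0 <= f -> 0 <= y ->
  exists s, [/\ 0 <= s, s <= y, perp f s & biperp f (y - s)].
Proof.
move=> f0 y0.
pose A := [set v : E | [/\ 0 <= v, v <= y & Order.meet v f = 0]].
have A0 : A 0 by split=> //; exact: meet_l.
have [||s [sub sl]] := E_complete (A := A); first by exists 0.
  by exists y => v [].
have s0 : 0 <= s by apply: sub.
have sy : s <= y by apply: sl => v [].
have sf : Order.meet s f = 0.
  apply/eqP; rewrite eq_le [X in _ && X]lexI s0 f0 !andbT; set m := Order.meet _ _.
  have m0 : 0 <= m by rewrite lexI s0.
  suff : s <= s - m by rewrite vle_subr -[leRHS]addr0 vleDl.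
  apply: sl => v [v0 vy vf]; rewrite vle_subr.
  have : v + m <= s.
    (* Disjoint elements below s have their sum below s. *)
    have vm : Order.meet v m = 0.
      rewrite meetC; apply: (@disjoint_le _ _ _ f) => //; first exact: leIr.
      by rewrite meetC.
    have ms : m <= s := leIl _ _.
    have vs : v <= s by apply: sub.
    have : v - (s - m) <= Order.meet v m.
      rewrite lexI vle_subid ?vsub_ge0//= vle_subl addrC subrK//.
    by rewrite vm vle_subl add0r vle_subr.
  by [].
exists s; split=> //; first exact: perp_ge0.
move=> w wf; rewrite ger0_vabs ?vsub_ge0//.
apply/eqP; rewrite eq_le [X in _ && X]lexI vsub_ge0 sy vabs_ge0 !andbT.
set b := Order.meet _ _.
have b0 : 0 <= b by rewrite lexI vsub_ge0 sy vabs_ge0.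
suff : s + b <= s by rewrite -[leRHS]addr0 vleDl.
apply: sub; split; first by rewrite vaddr_ge0.
  by rewrite addrC -vle_subr leIl.
apply: disjointD => //; apply: (@disjoint_le _ _ _ (vabs w)) => //.
exact: leIr.
Qed.

Lemma riesz_exists f x : 0 <= f -> exists s, perp f s /\ biperp f (x - s).
Proof.
move=> f0.
have [s [_ _ s1 s2]] := riesz_decomposition f0 (vpos_ge0 x).
have [t [_ _ t1 t2]] := riesz_decomposition f0 (vpos_ge0 (- x)).
exists (s - t); split.
  by rewrite addrC -scaleN1r; exact: perp_linear.
move=> w wf; rewrite -{1}(vposB x).
have -> : vpos x - vpos (- x) - (s - t) =
    (-1) *: (vpos (- x) - t) + (vpos x - s).
  by rewrite scaleN1r !opprB (addrC t (- s)) addrACA [RHS]addrC (addrC t).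
by apply: perp_linear; [exact: vabs_ge0|exact: t2|exact: s2].
Qed.

Lemma riesz_unique f s : perp f s -> biperp f s -> s = 0.
Proof. by move=> h /(_ _ h); rewrite meetxx => /vabs_eq0. Qed.

Definition perp_comp f x : E := xget 0 [set s | perp f s /\ biperp f (x - s)].

Lemma perp_compP f x : 0 <= f -> perp f (perp_comp f x) /\
  biperp f (x - perp_comp f x).
Proof.
move=> f0; rewrite /perp_comp; case: xgetP => [s _ //|].
by have [s hs] := riesz_exists x f0 => /(_ s).
Qed.

Lemma perp_compE f x s : 0 <= f -> perp f s -> biperp f (x - s) ->
  perp_comp f x = s.
Proof.
move=> f0 s1 s2; have [t1 t2] := perp_compP x f0.
apply/eqP; rewrite -subr_eq0; apply/eqP/(@riesz_unique f).
  by rewrite addrC -scaleN1r; exact: perp_linear.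
move=> w wf; have -> : perp_comp f x - s = (-1) *: (x - perp_comp f x) + (x - s).
  by rewrite scaleN1r opprB addrA subrK.
by apply: perp_linear; [exact: vabs_ge0|exact: t2|exact: s2].
Qed.

(** The proof of [0 <= f] is carried along so that the operator, which is linear
    for such f only, can be given its linear structure. *)
Definition perp_comp_of f of 0 <= f := perp_comp f.

Fact perp_comp_linear f (f0 : 0 <= f) : linear (perp_comp_of f0).
Proof.
move=> a x y; rewrite /perp_comp_of.
have [s1 s2] := perp_compP x f0; have [t1 t2] := perp_compP y f0.
apply: perp_compE => //; first exact: perp_linear.
move=> w wf; have -> : a *: x + y - (a *: perp_comp f x + perp_comp f y) =
    a *: (x - perp_comp f x) + (y - perp_comp f y).
  by rewrite scalerBr opprD addrACA.
by apply: perp_linear; [exact: vabs_ge0|exact: s2|exact: t2].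
Qed.

HB.instance Definition _ f (f0 : 0 <= f) :=
  GRing.isLinear.Build R E E *:%R (perp_comp_of f0) (perp_comp_linear f0).

(** The projection onto the band generated by f. *)
Definition band_comp f (f0 : 0 <= f) : {linear E -> E} := compl (perp_comp_of f0).

Lemma band_compE f (f0 : 0 <= f) x : band_comp f0 x = x - perp_comp f x.
Proof. by []. Qed.

Lemma band_comp_bproj f (f0 : 0 <= f) : bproj (band_comp f0).
Proof.
apply: bproj_compl; split=> [x|x x0].
  have [s1 s2] := perp_compP x f0.
  apply: perp_compE => // w wf; rewrite subrr ger0_vabs//.
  by apply: meet_l; exact: vabs_ge0.
have [s [s0 sx s1 s2]] := riesz_decomposition f0 x0.
by have e := perp_compE f0 s1 s2; rewrite -e in s0 sx.
Qed.

Lemma band_comp_id f (f0 : 0 <= f) : band_comp f0 f = f.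
Proof.
rewrite band_compE (@perp_compE _ _ 0) ?subr0//.
  by apply: perp_ge0 => //; exact: meet_l.
by move=> w wf; rewrite ger0_vabs// meetC.
Qed.

Lemma band_comp_disjoint f (f0 : 0 <= f) x : 0 <= x -> Order.meet x f = 0 ->
  band_comp f0 x = 0.
Proof.
move=> x0 xf; rewrite band_compE (@perp_compE _ _ x) ?subrr//.
  exact: perp_ge0.
move=> w wf; rewrite ger0_vabs//.
by apply: meet_l; exact: vabs_ge0.
Qed.

(** For y >= 0 the meet of S y and f is fixed by S and lies below f, where S
    vanishes; so S y is disjoint from f and from the band it belongs to. *)
Lemma band_comp_support f (f0 : 0 <= f) S : bproj S ->
  subproj S (band_comp f0) -> S f = 0 -> forall x, S x = 0.
Proof.
move=> hS sub Sf0.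
have h x : 0 <= x -> S x = 0.
  move=> x0; rewrite -sub; apply: band_comp_disjoint; first exact: bproj_ge0.
  have m0 : 0 <= Order.meet (S x) f by rewrite lexI bproj_ge0.
  have : S (Order.meet (S x) f) = Order.meet (S x) f.
    apply/eqP; rewrite -subr_eq0 -oppr_eq0 opprB -complE; apply/eqP.
    apply: (@bproj_ideal _ _ _ _ (S x)); first exact: bproj_compl.
      by rewrite ger0_vabs// leIl.
    by rewrite complE bproj_idem// subrr.
  move=> <-; apply: (@bproj_ideal _ _ _ _ f) => //.
  by rewrite ger0_vabs// leIr.
by move=> x; rewrite -(vposB x) linearB !h ?vpos_ge0// subrr.
Qed.

(** Where x is positive: the band generated by the positive part of x, on which
    the negative part vanishes. *)
Lemma localize x : exists P, [/\ bproj P, P x = vpos x &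
  forall S, bproj S -> subproj S P -> S (vpos x) = 0 ->
  forall y, S y = 0].
Proof.
exists (band_comp (vpos_ge0 x)); split.
- exact: band_comp_bproj.
- rewrite -[X in band_comp _ X](vposB x) linearB band_comp_id.
  by rewrite band_comp_disjoint ?vpos_ge0 ?subr0// meetC vpos_disjoint.
- by move=> S; exact: band_comp_support.
Qed.

(** An inequality that fails is reversed on a whole band, and is not an equality
    there; proofs of inequalities by contradiction start here. *)
Lemma localize_le P x y : bproj P -> ~~ (P x <= P y) -> exists Q,
  [/\ bproj Q, subproj Q P, Q y <= Q x & Q x <> Q y].
Proof.
move=> hP nle.
have [Q [hQ Qe _]] := localize (P x - P y).
exists (Q \o P); split=> /=.
- exact: bproj_comp.
- exact: subproj_comp_right.
- by rewrite -vsub_ge0 -linearB Qe vpos_ge0.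
- move=> e; move: nle => /negP; apply.
  have : vpos (P x - P y) = 0 by rewrite -Qe linearB e subrr.
  by move=> v0; rewrite -vsub_ge0 -vleN2 oppr0 opprB -v0 le_vpos.
Qed.

End existence.

(** * Operators on the complexification *)

Section complex_operators.
Local Open Scope complex_scope.
Context (R : realType) (E : banachLatticeType R).
Local Notation X := (complexification E).
Local Notation C := (R[i]).
Implicit Types (x y g : E) (z w : X) (P Q S : {linear E -> E}) (B : {linear X -> X}).

Lemma complexification_eta z : z = Cplx (cre z) (cim z). Proof. by case: z. Qed.

Lemma creB z w : cre (z - w) = cre z - cre w. Proof. by []. Qed.
Lemma cimZ (u : C) z :
  cim (u *: z) = complex.Re u *: cim z + complex.Im u *: cre z.
Proof. by []. Qed.

Definition cplx_op P (z : X) : X := Cplx (P (cre z)) (P (cim z)).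

Fact cplx_op_linear P : linear (cplx_op P).
Proof.
move=> a z w; rewrite /cplx_op creD cimD creZ cimZ.
have e : P (complex.Re a *: cre z - complex.Im a *: cim z + cre w) =
  complex.Re a *: P (cre z) - complex.Im a *: P (cim z) + P (cre w).
  by rewrite linearD linearB !linearZ.
have e' : P (complex.Re a *: cim z + complex.Im a *: cre z + cim w) =
  complex.Re a *: P (cim z) + complex.Im a *: P (cre z) + P (cim w).
  by rewrite !linearD !linearZ.
by rewrite e e'.
Qed.

HB.instance Definition _ P :=
  GRing.isLinear.Build C X X *:%R (cplx_op P) (cplx_op_linear P).

Lemma complexN1_norm : `|-1 : C| = 1. Proof. by rewrite normrN normr1. Qed.

Lemma complexi_norm : `|'i%C : C| = 1.
Proof. by rewrite normc_def/= expr0n/= expr1n add0r sqrtr1. Qed.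

Lemma modulusN z : modulus (- z) = modulus z.
Proof. by rewrite -scaleN1r modulusZ complexN1_norm scale1r. Qed.

Lemma modulusi z : modulus ('i%C *: z) = modulus z.
Proof. by rewrite modulusZ complexi_norm scale1r. Qed.

Lemma modulusB z w : modulus (z - w) = modulus (w - z).
Proof. by rewrite -modulusN opprB. Qed.

Lemma modulusBD z w : modulus (z - w) <= modulus z + modulus w.
Proof. by rewrite -(modulusN w) modulusD. Qed.

Lemma modulus_triangle z w : modulus z <= modulus (z - w) + modulus w.
Proof. by rewrite -{1}(subrK w z) modulusD. Qed.

Lemma vabs_cre z : vabs (cre z) <= modulus z.
Proof.
rewrite vabs_le -{1}[z]scale1r le_modulus ?normr1//=.
by rewrite -[- _]/(cre (- z)) -scaleN1r le_modulus// complexN1_norm.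
Qed.

Lemma vabs_cim z : vabs (cim z) <= modulus z.
Proof.
rewrite -modulusi; apply: le_trans (vabs_cre _).
by rewrite creZ/= scale0r sub0r scale1r vabsN.
Qed.

Lemma modulus_le_vabs z : modulus z <= vabs (cre z) + vabs (cim z).
Proof.
apply: modulus_le => u /unit_Re_Im[ua ub].
have := @cre_close R E u 0 z 1; rewrite !subr0 scale1r scale0r.
by rewrite [cre 0 + _]add0r; exact.
Qed.

Lemma modulus_real x : modulus (Cplx x 0) = vabs x.
Proof.
apply/eqP; rewrite eq_le (vabs_cre (Cplx x 0)) andbT.
by apply: (le_trans (modulus_le_vabs _)); rewrite /= (ger0_vabs (lexx 0)) addr0.
Qed.

Lemma modulus_cplx_op P z : positive P -> modulus (cplx_op P z) <= P (modulus z).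
Proof.
move=> hP; apply: modulus_le => u u1.
have -> : cre (u *: cplx_op P z) = P (cre (u *: z)).
  by rewrite !creZ linearB !linearZ.
by rewrite positive_le// le_modulus.
Qed.

(** As for [bproj_vabs]: the inequality for P and that for its complement add
    up to an equality. *)
Lemma modulus_bproj P z : bproj P -> modulus (cplx_op P z) = P (modulus z).
Proof.
move=> hP; apply/eqP; rewrite eq_le; apply/andP; split.
  by apply/modulus_cplx_op/bproj_positive.
have := modulus_cplx_op z (bproj_positive (bproj_compl hP)).
rewrite complE => h.
have zE : z = cplx_op P z + cplx_op (compl P) z.
  by case: z {h} => x y; rewrite /cplx_op/= /GRing.add/=; congr Cplx;
     rewrite addrC subrK.
have := modulusD (cplx_op P z) (cplx_op (compl P) z); rewrite -zE => /le_trans.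
move=> /(_ _ (vleD2 (lexx _) h)).
by rewrite addrCA -[X in X <= _]addr0 vleDl vsub_ge0.
Qed.

Lemma eq_cplx_op P Q z : (forall x, P x = Q x) -> cplx_op P z = cplx_op Q z.
Proof. by move=> h; rewrite /cplx_op !h. Qed.

Lemma cplx_op_idem P z : bproj P -> cplx_op P (cplx_op P z) = cplx_op P z.
Proof. by move=> hP; rewrite /cplx_op/= !bproj_idem. Qed.

Definition central (c : R) B : Prop := forall z, modulus (B z) <= c *: modulus z.

(** A central operator maps bands to themselves, those of P and of its
    complement in particular. *)
Lemma central_bproj c B P z : central c B -> bproj P ->
  cplx_op P (B z) = B (cplx_op P z).
Proof.
move=> hB hP.
have key S w : bproj S -> cplx_op S w = 0 -> cplx_op S (B w) = 0.
  move=> hS w0; apply: modulus_eq0; apply/eqP; rewrite eq_le modulus_ge0 andbT.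
  rewrite modulus_bproj//; apply: (le_trans (bproj_le hS (hB _))).
  by rewrite linearZ/= -modulus_bproj// w0 modulus0 scaler0.
have split w : w = cplx_op P w + cplx_op (compl P) w.
  by case: w => x y; rewrite /cplx_op/= /GRing.add/=; congr Cplx;
     rewrite addrC subrK.
rewrite [in LHS](split z) linearD linearD/= (key P (cplx_op (compl P) z))//.
  rewrite addr0 [RHS]split (key (compl P)) ?addr0//.
    exact: bproj_compl.
  by rewrite /cplx_op/= !bproj_idem// !subrr.
by rewrite /cplx_op/= !linearB !bproj_idem// !subrr.
Qed.

End complex_operators.

(** * Central operators are locally scalar *)

Section central_operators.
Local Open Scope complex_scope.
Context (R : realType) (E : banachLatticeType R).
Hypothesis E_complete : dedekind_complete E.
Local Notation X := (complexification E).
Local Notation C := (R[i]).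
Implicit Types (x y g : E) (z w u : X) (P Q S : {linear E -> E}) (B : {linear X -> X}).

Lemma absC_ge0 (s : C) : 0 <= complex.Re `|s|.
Proof. by have := normr_ge0 s; rewrite lecE => /andP[]. Qed.

Lemma vscale_le0 (a : R) g : 0 <= g -> g <> 0 -> a *: g <= 0 -> a <= 0.
Proof.
move=> g0 gn h; rewrite leNgt; apply/negP => a0; apply: gn; apply/eqP.
rewrite eq_le g0 andbT.
have := vle_scalel (_ : 0 <= a^-1) h; rewrite scaler0 scalerA mulVf ?gt_eqF// scale1r.
by apply; rewrite invr_ge0 ltW.
Qed.

Lemma vscale_le_inv (a b : R) g : 0 <= g -> g <> 0 -> a *: g <= b *: g -> a <= b.
Proof.
move=> g0 gn h; rewrite -subr_le0; apply: (vscale_le0 g0 gn).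
by rewrite scalerBl vle_subl add0r.
Qed.

(** Cut the range [-n g, n g] of x into slices of height e g.  Let m be the last
    level such that x lies above it on the whole band; x lies below the next
    level on some subband. *)
Lemma locally_scalar g P x (n e : R) : 0 <= g -> bproj P -> P g <> 0 ->
  P (vabs x) <= n *: P g -> 0 < e ->
  exists Q t, [/\ bproj Q, subproj Q P, Q g <> 0 &
    vabs (Q x - t *: Q g) <= e *: Q g].
Proof.
move=> g0 hP Pg xn e0.
pose t (k : nat) : R := k%:R * e - n.
have tS k : t k.+1 = t k + e by rewrite /t -natr1; lra.
have Px : vabs (P x) <= n *: P g by rewrite bproj_vabs.
have H0 : t 0 *: P g <= P x.
  rewrite /t mul0r sub0r scaleNr -vleN2 opprK.
  exact: le_trans (vleN_vabs _) Px.
have [k Hk] : exists k, ~~ (t k *: P g <= P x).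
  exists (Num.trunc (2 * n / e)).+1; apply/negP => H.
  have H2 := le_trans H (le_trans (vle_vabs _) Px).
  have := vscale_le_inv (bproj_ge0 hP g0) Pg H2.
  apply/negP; rewrite -ltNge /t.
  have [n0|n0] := leP 0 n; last first.
    have : 0 <= (Num.trunc (2 * n / e)).+1%:R * e :> R by rewrite mulr_ge0// ltW.
    by lra.
  have /andP[_] := @truncn_itv _ (2 * n / e) (divr_ge0 (mulr_ge0 (ler0n _ _) n0) (ltW e0)).
  by rewrite ltr_pdivrMr//; lra.
have ex : exists k, ~~ (t k *: P g <= P x) by exists k.
case: (ex_minnP ex) => -[|m] {k Hk} Hm mmin; first by rewrite H0 in Hm.
have {mmin ex} Hm' : t m *: P g <= P x.
  by apply: contraT => /mmin; rewrite ltnn.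
rewrite -linearZ/= in Hm.
have [Q [hQ QP Qle Qne]] := localize_le E_complete hP Hm.
have Q_P y : Q (P y) = Q y := subproj_r y hP hQ QP.
exists Q, (t m); split => //.
  move=> Qg; apply: Qne; rewrite linearZ/= Qg scaler0; apply/esym/vabs_eq0.
  apply/eqP; rewrite eq_le vabs_ge0 andbT bproj_vabs// -Q_P.
  by apply: (le_trans (bproj_le hQ xn)); rewrite linearZ/= Q_P Qg scaler0.
rewrite vabs_le opprB; apply/andP; split.
  by rewrite vle_subl -scalerDl addrC -tS -linearZ.
rewrite vle_subl (le_trans (y := Q x))//.
  by have := bproj_le hQ Hm'; rewrite linearZ/= !Q_P.
by apply: vle_addl; apply: vscale_ge0; [exact: ltW|exact: bproj_ge0].
Qed.

Lemma locally_scalar_cplx g P z (n e : R) : 0 <= g -> bproj P -> P g <> 0 ->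
  P (modulus z) <= n *: P g -> 0 < e ->
  exists Q (t : C), [/\ bproj Q, subproj Q P, Q g <> 0 &
    modulus (cplx_op Q (z - t *: Cplx g 0)) <= e *: Q g].
Proof.
move=> g0 hP Pg zn e0; have e2 : 0 < e / 2 by lra.
have [|Q [t [hQ QP Qg Qx]]] := @locally_scalar g P (cre z) n _ g0 hP Pg _ e2.
  by apply: le_trans zn; rewrite bproj_le// vabs_cre.
have Q_P y : Q (P y) = Q y := subproj_r y hP hQ QP.
have [|S [s [hS SQ Sg Sx]]] := @locally_scalar g Q (cim z) n _ g0 hQ Qg _ e2.
  apply: (@le_trans _ _ (Q (modulus z))); first by rewrite bproj_le// vabs_cim.
  by have := bproj_le hQ zn; rewrite linearZ/= !Q_P.
have S_Q y : S (Q y) = S y := subproj_r y hQ hS SQ.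
exists S, (t +i* s); split => //; first exact: subproj_trans QP.
apply: (le_trans (modulus_le_vabs _)); rewrite /= !scaler0 subr0 add0r.
rewrite [e](splitr e) scalerDl vleD2//; last by rewrite linearB linearZ.
rewrite linearB linearZ/= -(S_Q (cre z)) -(S_Q g) -linearZ -linearB/= bproj_vabs//.
by have := bproj_le hS Qx; rewrite [leRHS]linearZ/=.
Qed.

(** The band generated by g contains the band of P. *)
Definition weak_unit P (g : E) : Prop := forall S, bproj S -> subproj S P ->
  S g = 0 -> forall x, S x = 0.

(** If the conclusion fails, a margin eta |u| separates the two sides on a
    subband.  On a smaller one u and w are, up to e |u|, scalar multiples of
    the real element |u|, hence w is close to s u for a complex s, and the
    bound for B u passes to w with an error tending to 0 with e. *)
Lemma central_le c b B P u : 0 <= c -> 0 <= b -> central c B -> bproj P ->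
  weak_unit P (modulus u) -> P (modulus (B u)) <= b *: P (modulus u) ->
  forall w, P (modulus (B w)) <= b *: P (modulus w).
Proof.
move=> c0 b0 cB hP wu Bu w; rewrite -[leRHS]add0r -vle_subl.
pose g := modulus u; have g0 : 0 <= g := modulus_ge0 _.
apply: (@vle0_arch _ _ _ (P g)) => eta eta0; apply: contraT => nle.
have {nle} : ~~ (P (modulus (B w)) <= P (b *: modulus w + eta *: g)).
  by move: nle; rewrite vle_subl linearD !linearZ/= addrC.
move=> /(localize_le E_complete hP)[Q1 [h1 Q1P Q1le Q1ne]].
have Q1g : Q1 g <> 0 by move=> /(wu _ h1 Q1P) Q0; apply: Q1ne; rewrite !Q0.
(* On some subband w is bounded by a multiple of u. *)
have [n] : exists n : nat, ~~ (Q1 (n%:R *: g) <= Q1 (modulus w)).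
  apply: contrapT => /forallNP h; apply: Q1g; apply/eqP.
  rewrite eq_le bproj_ge0// andbT; apply: (@vle0_archn _ _ _ (Q1 (modulus w))) => n.
  by rewrite -linearZ/=; apply: contrapT => /negP; exact: h.
move=> /(localize_le E_complete h1)[Q2 [h2 Q21 Q2le Q2ne]].
have Q2P : subproj Q2 P := subproj_trans Q21 Q1P.
have Q2g : Q2 g <> 0 by move=> /(wu _ h2 Q2P) Q0; apply: Q2ne; rewrite !Q0.
rewrite linearZ/= in Q2le.
pose k : R := (c + b + 1) * (2 * n%:R + 3).
have n0 : 0 <= n%:R :> R by [].
have k0 : 0 < k by rewrite mulr_gt0//; lra.
pose e := Num.min (2^-1) (eta / k).
have e0 : 0 < e by rewrite lt_min invr_gt0 divr_gt0//= ltr0n.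
have e12 : e <= 2^-1 by rewrite ge_min lexx.
have ek : e * k <= eta by rewrite -ler_pdivlMr// ge_min lexx orbT.
have [|Q3 [a [h3 Q32 Q3g Q3u]]] :=
  @locally_scalar_cplx g Q2 u 1 e g0 h2 Q2g _ e0; first by rewrite scale1r.
have Q3_2 y : Q3 (Q2 y) = Q3 y := subproj_r y h2 h3 Q32.
have [|Q [t [hQ Q43 Qg Qw]]] := @locally_scalar_cplx g Q3 w n%:R e g0 h3 Q3g _ e0.
  by have := bproj_le h3 Q2le; rewrite linearZ/= !Q3_2.
have Q_3 y : Q (Q3 y) = Q y := subproj_r y h3 hQ Q43.
have {}Q3u : modulus (cplx_op Q (u - a *: Cplx g 0)) <= e *: Q g.
  rewrite modulus_bproj// -Q_3 -modulus_bproj//.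
  by have := bproj_le hQ Q3u; rewrite [leRHS]linearZ/= Q_3.
pose G := cplx_op Q (Cplx g 0); pose u' := cplx_op Q u; pose w' := cplx_op Q w.
pose g' := Q g; have g'0 : 0 <= g' := bproj_ge0 hQ g0.
have GE : modulus G = g' by rewrite modulus_bproj// modulus_real ger0_vabs.
have uE : modulus u' = g' by rewrite modulus_bproj.
have Q41 : subproj Q Q1 := subproj_trans Q43 (subproj_trans Q32 Q21).
have Q_1 y : Q (Q1 y) = Q y := subproj_r y h1 hQ Q41.
have QPs : subproj Q P := subproj_trans Q41 Q1P.
have Q_P y : Q (P y) = Q y := subproj_r y hP hQ QPs.
have Q_2 y : Q (Q2 y) = Q y := subproj_r y h2 hQ (subproj_trans Q43 Q32).
have wn : modulus w' <= n%:R *: g'.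
  by rewrite modulus_bproj//; have := bproj_le hQ Q2le; rewrite linearZ/= !Q_2.
have ud : modulus (u' - a *: G) <= e *: g'.
  by move: Q3u; rewrite linearB/= linearZ.
have wd : modulus (w' - t *: G) <= e *: g'.
  by move: Qw; rewrite linearB/= linearZ.
have lower : b *: modulus w' + eta *: g' <= modulus (B w').
  rewrite -(central_bproj _ cB hQ) !modulus_bproj//.
  by have := bproj_le hQ Q1le; rewrite !Q_1 linearD !linearZ.
have Bu' : modulus (B u') <= b *: g'.
  rewrite -(central_bproj _ cB hQ) modulus_bproj//.
  by have := bproj_le hQ Bu; rewrite linearZ/= !Q_P.
(* u is close to a |u|, hence |a| is close to 1 and division by a is safe. *)
have a12 : 2^-1 <= complex.Re `|a|.
  have : 1 *: g' <= (e + complex.Re `|a|) *: g'.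
    rewrite scale1r scalerDl -{1}uE -GE -modulusZ.
    by apply: (le_trans (modulus_triangle _ (a *: G))); rewrite vleD2r GE.
  by move=> /(vscale_le_inv g'0 Qg); lra.
have an0 : a != 0.
  by apply: contraL isT => /eqP a0; move: a12; rewrite a0 normr0/=; lra.
pose s := t / a.
have sa : s *: (a *: G) = t *: G by rewrite scalerA divfK.
have sn : complex.Re `|s| <= 2 * n%:R + 2.
  have : (complex.Re `|s| * 2^-1) *: g' <= (n%:R + e) *: g'.
    rewrite -scalerA; apply: (@le_trans _ _ (complex.Re `|s| *: modulus (a *: G))).
      by rewrite vle_scalel ?absC_ge0// modulusZ GE vscale_le_l.
    rewrite -modulusZ sa addrC scalerDl.
    apply: (le_trans (modulus_triangle _ w')).
    by rewrite vleD2// modulusB.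
  by move=> /(vscale_le_inv g'0 Qg); lra.
pose ka := e * (2 * n%:R + 3).
have wsu : modulus (w' - s *: u') <= ka *: g'.
  apply: (@le_trans _ _ (e *: g' + complex.Re `|s| *: (e *: g'))).
    have -> : w' - s *: u' = (w' - t *: G) - s *: (u' - a *: G).
      by rewrite scalerBr sa opprB addrA subrK.
    apply: (le_trans (modulusBD _ _)); rewrite vleD2// modulusZ.
    by rewrite vle_scalel ?absC_ge0.
  rewrite scalerA -scalerDl vscale_le_l// /ka.
  rewrite [leRHS](_ : _ = e + (2 * n%:R + 2) * e); last by lra.
  by rewrite lerD2l ler_pM2r.
have upper : modulus (B w') <= b *: modulus w' + ((c + b) * ka) *: g'.
  have -> : B w' = B (w' - s *: u') + s *: B u'.
    by rewrite linearB linearZ/= subrK.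
  apply: (le_trans (modulusD _ _)); rewrite modulusZ mulrDl scalerDl addrCA.
  rewrite vleD2//.
    by rewrite (le_trans (cB _))// -scalerA vle_scalel.
  apply: (le_trans (vle_scalel (absC_ge0 s) Bu')).
  rewrite scalerA mulrC -!scalerA -scalerDr vle_scalel//.
  rewrite -uE -modulusZ; apply: (le_trans (modulus_triangle _ w')).
  by rewrite addrC vleDl modulusB uE scalerA.
have := le_trans lower upper; rewrite vleDl => /(vscale_le_inv g'0 Qg).
have : (c + b) * ka < eta.
  apply: lt_le_trans ek; rewrite /ka /k mulrC mulrAC -!mulrA ltr_pM2l//.
  by rewrite ltr_pM2r; lra.
by move=> /lt_le_trans h /h; rewrite ltxx.
Qed.

(** Where B w were smaller than b |w|, [central_le] with w as generator would
    make B u smaller than b |u|, against the bound by the larger a. *)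
Lemma central_ge c a b B P u : 0 <= c -> 0 <= b -> b < a -> central c B -> bproj P ->
  weak_unit P (modulus u) -> a *: P (modulus u) <= P (modulus (B u)) ->
  forall w, b *: P (modulus w) <= P (modulus (B w)).
Proof.
move=> c0 b0 ba cB hP wu Bu w; apply: contraT.
rewrite -linearZ/= => /(localize_le E_complete hP)[Q [hQ QP Qle Qne]].
rewrite linearZ/= in Qle.
have Q_P y : Q (P y) = Q y := subproj_r y hP hQ QP.
have [S [hS Se Su]] := localize E_complete (Q (modulus w)).
have w0 : 0 <= Q (modulus w) by rewrite bproj_ge0// modulus_ge0.
have vw : vpos (Q (modulus w)) = Q (modulus w) by apply: join_l.
rewrite vw in Se Su.
have hSQ : bproj (S \o Q) := bproj_comp hS hQ.
have sQ : subproj (S \o Q) Q := subproj_comp_right hQ hS.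
have [Sw0|Swn0] := pselect (S (Q (modulus w)) = 0).
  exfalso; apply: Qne.
  have wz : Q (modulus w) = 0 by rewrite -Se.
  rewrite linearZ/= wz scaler0; apply/eqP; rewrite eq_sym eq_le.
  by rewrite bproj_ge0 ?modulus_ge0// andbT (le_trans Qle)// wz scaler0.
have wSQ : weak_unit (S \o Q) (modulus w).
  move=> T hT TS Tw; apply: (Su _ hT).
    by apply: subproj_trans TS _; exact: subproj_comp_left.
  have T_Q : subproj T Q := subproj_trans TS sQ.
  by rewrite (subproj_r _ hQ hT T_Q).
have h : S (Q (modulus (B u))) <= b *: S (Q (modulus u)).
  apply: (central_le c0 b0 cB hSQ wSQ _ u).
  by have := bproj_le hS Qle; rewrite linearZ.
have h2 : a *: S (Q (modulus u)) <= S (Q (modulus (B u))).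
  rewrite -(Q_P (modulus u)) -linearZ/= -(Q_P (modulus (B u))) -linearZ/=.
  by apply: bproj_le hS _; exact: bproj_le.
have Su0 : S (Q (modulus u)) = 0.
  apply: contrapT => ne; have := le_trans h2 h.
  have p0 : 0 <= S (Q (modulus u)) by do 2?apply: bproj_ge0 => //; exact: modulus_ge0.
  by move=> /(vscale_le_inv p0 ne); rewrite leNgt ba.
exfalso; apply: Swn0; apply: (wu (S \o Q) hSQ) => //.
exact: subproj_trans sQ QP.
Qed.

End central_operators.

(** * Growth of the powers of a positive operator *)

Section growth.
Context (R : realType) (E : banachLatticeType R).
Implicit Types (x y a : E) (s t c q e : R) (V : {linear E -> E}) (S W : E -> E).

Lemma exprn_small q e : 0 <= q -> q < 1 -> 0 < e -> exists n : nat, q ^+ n <= e.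
Proof.
move=> q0 q1 e0; have /cvgrPdist_le/(_ _ e0) : (GRing.exp q : nat -> R) @ \oo --> (0 : R).
  by apply: cvg_expr; rewrite ger0_norm.
move=> [n _ /(_ n (leqnn n))] /=; rewrite sub0r normrN ger0_norm ?exprn_ge0// => h.
by exists n.
Qed.

(** The solution of y = a + W y is the limit of the partial sums of the Neumann
    series y - W^n y = a + W a + ... + W^(n-1) a, which are positive. *)
Lemma fixed_point_ge0 W q y a : {morph W : x y / x - y} ->
  (forall x, 0 <= x -> 0 <= W x) -> 0 <= q -> q < 1 ->
  (forall x, `|W x| <= q * `|x|) -> 0 <= a -> y = a + W y -> 0 <= y.
Proof.
move=> WB Wpos q0 q1 Wq a0 ya; apply: vge0_closed => e e0.
have n0 : 0 < `|y| + 1 by rewrite ltr_wpDl.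
have [n hn] := exprn_small q0 q1 (divr_gt0 e0 n0).
exists (y - iter n W y).
  elim: n {hn} => [|n ih] /=; first by rewrite subrr.
  by rewrite {1}ya -addrA -WB vaddr_ge0// Wpos.
rewrite addrAC subrr add0r normrN.
have : `|iter n W y| <= q ^+ n * `|y|.
  elim: n {hn} => [|n ih] /=; first by rewrite mul1r.
  by rewrite (le_trans (Wq _))// exprS -mulrA ler_wpM2l.
move=> /le_trans; apply; apply: (@le_trans _ _ (e / (`|y| + 1) * `|y|)).
  by rewrite ler_wpM2r.
by rewrite -mulrA ger_pMr// mulrC ler_pdivrMr// mul1r; lra.
Qed.

Definition resolvent V s S : Prop :=
  (forall x, S (s *: x - V x) = x) /\ (forall x, s *: S x - V (S x) = x).

Lemma resolventB V s S : resolvent V s S -> {morph S : x y / x - y}.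
Proof.
move=> [h1 h2] x y; rewrite -[RHS]h1; congr S.
rewrite [V _]linearB scalerBr [in RHS]opprD addrACA -[- _ - - _]opprD.
by rewrite !h2.
Qed.

Definition positive_resolvent V s c : Prop := exists S,
  [/\ resolvent V s S, forall x, 0 <= x -> 0 <= S x &
      forall x, `|S x| <= c * `|x|].

Lemma resolvent_shift V s t S x : resolvent V s S -> forall y,
  t *: y - V y = x -> y = S (x + (s - t) *: y).
Proof.
move=> [h1 _] y yx; rewrite -[LHS]h1 -yx; congr S.
by rewrite scalerBl addrAC; congr (_ - _); rewrite addrC subrK.
Qed.
(** With S and T the resolvents at t and s, S x solves y = T x + (s - t) T y,
    a contraction with positive data. *)
Lemma positive_resolvent_near V s t c S : resolvent V t S ->
  (exists d, forall x, `|S x| <= d * `|x|) ->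
  positive_resolvent V s c -> 0 <= s - t -> 0 <= c -> (s - t) * c < 1 ->
  exists d, positive_resolvent V t d.
Proof.
move=> hS [d Sd] [T [hT Tpos Tc]] st0 c0 stc; exists d, S; split => // x x0.
have := resolvent_shift hT (proj2 hS x).
have TD u v : T (u + v) = T u + T v.
  have := resolventB hT (u + v) v; rewrite addrK => ->; by rewrite subrK.
rewrite TD => e.
apply: (@fixed_point_ge0 (fun y => T ((s - t) *: y)) ((s - t) * c) _ (T x)) => //.
- by move=> u v /=; rewrite scalerBr (resolventB hT).
- by move=> u u0; apply: Tpos; exact: vscale_ge0.
- exact: mulr_ge0.
- move=> u; apply: (le_trans (Tc _)); rewrite normrZ ger0_norm//.
  by rewrite mulrCA mulrA.
- exact: Tpos.
Qed.

(** Let u be the supremum of the parameters at or above s where the resolvent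
    is not positive; large parameters are excluded by the Neumann series.  The
    resolvent at u bounds the resolvents slightly above u, so positivity
    reaches a fixed distance below u, a contradiction. *)
Lemma positive_resolvents V (M : R) : positive V -> 0 <= M ->
  (forall x, `|V x| <= M * `|x|) ->
  (forall s, 1 < s -> exists S, resolvent V s S /\
     exists c, forall x, `|S x| <= c * `|x|) ->
  forall s, 1 < s -> exists c, positive_resolvent V s c.
Proof.
move=> Vpos M0 VM res s s1; apply: contrapT => nres.
pose N := [set t | s <= t /\ ~ exists c, positive_resolvent V t c].
have Ns : N s by split.
have large t : s <= t -> M < t -> exists c, positive_resolvent V t c.
  move=> st Mt; have t0 : 0 < t by lra.
  have [S [hS [c Sc]]] := res t (lt_le_trans s1 st).
  exists c, S; split => // x x0.
  apply: (@fixed_point_ge0 (fun y => t^-1 *: V y) (M / t) _ (t^-1 *: x)) => //.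
  - by move=> u v; rewrite linearB scalerBr.
  - by move=> u u0; apply: vscale_ge0; [rewrite invr_ge0 ltW|exact: Vpos].
  - by apply: divr_ge0; last exact: ltW.
  - by rewrite ltr_pdivrMr// mul1r.
  - move=> u; rewrite normrZ ger0_norm ?invr_ge0; last exact: ltW.
    by rewrite mulrC mulrAC ler_pM2r ?invr_gt0.
  - by apply: vscale_ge0 => //; rewrite invr_ge0 ltW.
  - have xe : x + V (S x) = t *: S x.
      by apply/esym/eqP; rewrite -subr_eq (proj2 hS).
    by rewrite -scalerDr xe scalerA mulVf ?scale1r// gt_eqF.
have Nub : has_sup N.
  split; first by exists s.
  exists M => t [st nt]; rewrite leNgt; apply/negP => Mt.
  by apply: nt; exact: large.
pose u := sup N.
have su : s <= u by apply: ub_le_sup => //; case: Nub.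
have [S [hS [c Sc]]] := res u (lt_le_trans s1 su).
pose K := Num.max c 1.
have K1 : 1 <= K by rewrite le_max lexx orbT.
have K0 : 0 < K by lra.
have SK x : `|S x| <= K * `|x|.
  by apply: (le_trans (Sc x)); rewrite ler_wpM2r// le_max lexx.
pose d := (8 * K)^-1.
have Kd : K * d = 8^-1 by rewrite /d invfM mulrCA mulfV ?mulr1// gt_eqF.
have d0 : 0 < d by rewrite invr_gt0 mulr_gt0.
pose t := u + d.
have [c' [T [hT Tpos _]]] : exists c, positive_resolvent V t c.
  apply: contrapT => nt; have : t <= u.
    apply: ub_le_sup; first by case: Nub.
    by split => //; rewrite /t; lra.
  by rewrite /t; lra.
(* The resolvent identity bounds T by twice the bound of the resolvent at u. *)
have TK x : `|T x| <= 2 * K * `|x|.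
  have := SK (x + (u - t) *: T x); rewrite -(resolvent_shift hS (proj2 hT x)).
  have -> : u - t = - d by rewrite /t; lra.
  have := ler_normD x (- d *: T x); rewrite normrZ normrN (ger0_norm (ltW d0)).
  move=> /(ler_wpM2l (ltW K0)); rewrite mulrDr mulrA Kd.
  have : 0 <= K * `|x| by rewrite mulr_ge0// ltW.
  have := normr_ge0 (T x); lra.
have [v [sv nv] uv] := sup_adherent d0 Nub; rewrite -/u in uv.
have vu : v <= u by apply: ub_le_sup => //; case: Nub.
apply: nv; have [W [hW Wc]] := res v (lt_le_trans s1 sv).
apply: (@positive_resolvent_near _ t _ (2 * K) W) => //.
- by exists T.
- by rewrite /t; lra.
- by rewrite mulr_ge0// ltW.
- apply: (@le_lt_trans _ _ (2 * d * (2 * K))).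
    by rewrite ler_pM2r ?mulr_gt0// /t; lra.
  by have := Kd; lra.
Qed.

(** For x >= 0 put y = S x, so that s y = x + V y dominates both x and V y.
    Hence V^n y <= s^n y and V^n x <= s^(n+1) y. *)
Lemma positive_growth V (M : R) : positive V -> 0 <= M ->
  (forall x, `|V x| <= M * `|x|) ->
  (forall s, 1 < s -> exists S, resolvent V s S /\
     exists c, forall x, `|S x| <= c * `|x|) ->
  forall s, 1 < s -> exists2 K : R, 0 < K &
    forall n x, `|iter n V x| <= K * s ^+ n * `|x|.
Proof.
move=> Vpos M0 VM res s s1.
have [c [S [[_ hS] Spos Sc]]] := positive_resolvents Vpos M0 VM res s1.
pose K := Num.max (s * c) 1.
have K0 : 0 < K by rewrite lt_max ltr01 orbT.
have s0 : 0 < s by lra.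
exists K => // n x.
have mono (m : nat) u v : u <= v -> iter m V u <= iter m V v.
  by move=> uv; elim: m => //= m ih; exact: positive_le.
have key y : 0 <= y -> iter n V y <= s ^+ n.+1 *: S y.
  move=> y0; have Sy : s *: S y = y + V (S y).
    by apply/eqP; rewrite -subr_eq hS.
  have it m : iter m V (S y) <= s ^+ m *: S y.
    elim: m => [|m ih] /=; first by rewrite scale1r.
    apply: (le_trans (positive_le Vpos ih)); rewrite linearZ/= exprSr -scalerA.
    by rewrite vle_scalel ?exprn_ge0 ?(ltW s0)// Sy vle_addl.
  apply: (@le_trans _ _ (iter n V (s *: S y))).
    by apply: mono; rewrite Sy addrC vle_addl// Vpos// Spos.
  have -> : iter n V (s *: S y) = s *: iter n V (S y).
    by elim: n {it mono} => //= m ->; rewrite linearZ.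
  by rewrite exprS -scalerA vle_scalel// (ltW s0).
have vi : vabs (iter n V x) <= iter n V (vabs x).
  elim: n {key mono} => //= m ih.
  by apply: (le_trans (positive_vabs _ Vpos)); exact: positive_le.
apply: (@le_trans _ _ `|s ^+ n.+1 *: S (vabs x)|).
  by apply: vabs_norm_le; apply: (le_trans vi); exact/key/vabs_ge0.
rewrite normrZ ger0_norm ?exprn_ge0 ?(ltW s0)// exprSr (mulrC K) -!mulrA.
rewrite ler_wpM2l ?exprn_ge0 ?(ltW s0)//.
rewrite -norm_vabs; apply: (@le_trans _ _ (s * c * `|vabs x|)).
  by rewrite -mulrA ler_wpM2l ?(ltW s0)// norm_vabs.
by rewrite norm_vabs ler_wpM2r// le_max lexx.
Qed.
End growth.

(** * Powers of an operator *)

Section powers.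
Context (K : pzRingType) (M : lmodType K).
Implicit Types (V U : {linear M -> M}).

Fixpoint pow V (n : nat) : {linear M -> M} :=
  if n is m.+1 then V \o pow V m else idfun.

Lemma powS V n x : pow V n.+1 x = V (pow V n x). Proof. by []. Qed.

Lemma powE V n x : pow V n x = iter n V x.
Proof. by elim: n => //= n ->. Qed.

Lemma powSr V n x : pow V n.+1 x = pow V n (V x).
Proof. by rewrite !powE iterSr. Qed.

Lemma powD V m n x : pow V (m + n) x = pow V m (pow V n x).
Proof. by rewrite !powE iterD. Qed.

Lemma powM V m n x : pow V (m * n) x = pow (pow V m) n x.
Proof. by elim: n => [|n ih]; rewrite ?muln0// mulnS powD ih. Qed.

Lemma powK U V n : cancel U V -> cancel (pow U n) (pow V n).
Proof. by move=> UV; elim: n => [//|n ih] x; rewrite (powSr V) powS UV ih. Qed.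

End powers.

(** * Lattice automorphisms *)

Section automorphisms.
Context (R : realType) (E : banachLatticeType R).
Hypothesis E_complete : dedekind_complete E.
Local Notation X := (complexification E).
Implicit Types (x y g : E) (z w u : X) (P Q S U V W : {linear E -> E}).

Definition lattice_iso U V : Prop :=
  [/\ positive U, positive V, cancel U V & cancel V U].

Lemma lattice_iso_sym U V : lattice_iso U V -> lattice_iso V U.
Proof. by case. Qed.

Lemma lattice_iso_pow U V n : lattice_iso U V -> lattice_iso (pow U n) (pow V n).
Proof.
have pp W : positive W -> positive (pow W n).
  by move=> hW; elim: n => //= m ih x x0; apply: hW; exact: ih.
by case=> U0 V0 UV VU; split; [exact: pp|exact: pp|exact: powK|exact: powK].
Qed.

Lemma lattice_iso_modulus U V z : lattice_iso U V ->
  modulus (cplx_op U z) = U (modulus z).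
Proof.
move=> [U0 V0 UV VU]; apply/eqP; rewrite eq_le modulus_cplx_op//=.
rewrite -{1}(_ : cplx_op V (cplx_op U z) = z).
  by apply: (le_trans (positive_le U0 (modulus_cplx_op _ V0))); rewrite VU.
by case: z => x y; rewrite /cplx_op/= !UV.
Qed.

(** The projection onto the image under U of the band of P, V being the inverse
    of U. *)
Definition transport U V P : {linear E -> E} := U \o (P \o V).

Lemma transportE U V P x : transport U V P x = U (P (V x)). Proof. by []. Qed.

Lemma transport_bproj U V P : lattice_iso U V -> bproj P -> bproj (transport U V P).
Proof.
move=> [U0 V0 UV VU] hP; split=> [x|x x0]; rewrite !transportE.
  by rewrite UV bproj_idem.
split; first by apply: U0; apply: bproj_ge0 => //; exact: V0.
by rewrite -{2}(VU x) positive_le// bproj_le_id// V0.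
Qed.

Lemma transportK U V P x : lattice_iso U V -> transport V U (transport U V P) x = P x.
Proof. by move=> [_ _ UV _]; rewrite !transportE !UV. Qed.

Lemma transport_weak_unit U V P g : lattice_iso U V -> weak_unit P g ->
  weak_unit (transport U V P) (U g).
Proof.
move=> iso wu S hS SP Sg x.
have [_ _ UV VU] := iso.
have h y : transport V U S y = 0.
  apply: wu => [|v|]; first exact: transport_bproj (lattice_iso_sym iso) hS.
    by have := SP (U v); rewrite !transportE => /(congr1 V); rewrite !UV.
  by rewrite transportE Sg linear0.
by have := h (V x); rewrite transportE VU => /(congr1 U); rewrite VU linear0.
Qed.

(** W moves the band of P off itself. *)
Definition wandering W P : Prop := forall x, P (W (P x)) = 0.

Lemma wandering_sub W P Q : bproj P -> bproj Q -> subproj Q P ->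
  wandering W P -> wandering W Q.
Proof.
move=> hP hQ QP h x; rewrite -(subproj_r _ hP hQ QP) -(QP x) h.
exact: linear0.
Qed.

(** If W does not commute with some S <= P, then S and its image T differ; the
    part of S outside T is moved into T, and if there is none, the part of S
    outside its preimage is moved outside S. *)
Lemma wandering_or_commute W W' P : lattice_iso W W' -> bproj P ->
  (exists Q, [/\ bproj Q, subproj Q P, exists x, Q x <> 0 & wandering W Q]) \/
  (forall S, bproj S -> subproj S P -> forall x, W (S x) = S (W x)).
Proof.
move=> iso hP; have [_ _ WW W'W] := iso.
have [|h] := pselect (forall S, bproj S -> subproj S P -> forall x, W (S x) = S (W x)).
  by right.
left; move: h => /existsNP[S /not_implyP[hS /not_implyP[SP /existsNP[x Wx]]]].
have hT := transport_bproj iso hS; have hT' := transport_bproj (lattice_iso_sym iso) hS.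
set T := transport W W' S in hT; set T' := transport W' W S in hT'.
have TW y : T (W y) = W (S y) by rewrite transportE WW.
have [[y Sy]|Sz] := pselect (exists y, (S \o compl T) y <> 0).
  exists (S \o compl T); split; first exact: bproj_comp (bproj_compl hT).
  - by move=> u /=; rewrite SP.
  - by exists y.
  - have e v : compl T (W (S v)) = 0 by rewrite complE -TW bproj_idem// subrr.
    by move=> u; rewrite -[LHS]/(S (compl T (W (S (compl T u))))) e linear0.
have {}Sz y : S y = S (T y).
  apply/eqP; rewrite -subr_eq0 -linearB; apply/eqP.
  by apply: contrapT => h; apply: Sz; exists y.
exists (S \o compl T'); split; first exact: bproj_comp (bproj_compl hT').
- by move=> u /=; rewrite SP.
- apply: contrapT => /forallNP h; apply: Wx.
  have {}h y : S y = S (T' y).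
    by apply/eqP; rewrite -subr_eq0 -linearB; apply/eqP; apply: contrapT; exact: h.
  have TS y : T y = T (S y).
    have := h (W' y); rewrite transportE W'W => /(congr1 W).
    by rewrite -[LHS]/(T y) -[RHS]/(T (S y)).
  by rewrite -TW TS (bproj_comm _ hT hS) -Sz.
- move=> u; have hC := bproj_compl hT'.
  have e v : S (W (compl T' (S v))) = 0.
    by rewrite complE transportE linearB W'W linearB bproj_idem// subrr.
  rewrite -[LHS]/(S (compl T' (W (S (compl T' u))))).
  by rewrite (bproj_comm _ hS hC) (bproj_comm u hS hC) e linear0.
Qed.

End automorphisms.

(** * Wandering and periodic bands *)

Section periodicity.
Context (R : realType) (E : banachLatticeType R).
Hypothesis E_complete : dedekind_complete E.
Implicit Types (x y g : E) (P Q S U V W : {linear E -> E}).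

Definition nonzero P : Prop := exists x, P x <> 0.

(** Induction on m: a band wandering for m steps either contains one that also
    wanders at step m + 1, or is fixed, with all its subbands, by U^(m+1). *)
Lemma wandering_or_periodic U V P (m : nat) : lattice_iso U V -> bproj P ->
  nonzero P -> exists Q, [/\ bproj Q, subproj Q P, nonzero Q &
   (forall j, (0 < j <= m)%N -> wandering (pow U j) Q) \/
   (exists p, [/\ (0 < p <= m)%N,
      forall j, (0 < j < p)%N -> wandering (pow U j) Q &
      forall S, bproj S -> subproj S Q -> forall x, pow U p (S x) = S (pow U p x)])].
Proof.
move=> iso hP nzP; elim: m => [|m [Q [hQ QP nzQ]]].
  exists P; split=> //; first exact: subproj_refl.
  by left => -[|j].
case=> [free|[p [/andP[p0 pm] free per]]]; last first.
  exists Q; split=> //; right; exists p; split=> //.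
  by rewrite p0 (leq_trans pm).
have [[S [hS SQ nzS Sw]]|per] := wandering_or_commute (lattice_iso_pow m.+1 iso) hQ.
  exists S; split=> //; first exact: subproj_trans QP.
  left => j /andP[j0]; rewrite leq_eqVlt => /orP[/eqP -> //|jm].
  by apply: wandering_sub SQ _ => //; apply: free; rewrite j0.
exists Q; split=> //; right; exists m.+1; split=> //.
by rewrite leqnn.
Qed.

(** What is left of the hypothesis on the spectrum. *)
Definition subexponential U : Prop := forall s : R, 1 < s ->
  exists2 K : R, 0 < K & forall n x, `|pow U n x| <= K * s ^+ n * `|x|.

Lemma bernoulli_upper (d : R) p : 0 <= d -> d <= 1 -> (1 + d) ^+ p <= 1 + d * 3 ^+ p.
Proof.
move=> d0 d1; elim: p => [|p ih]; first by rewrite !expr0; lra.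
rewrite exprS; apply: (@le_trans _ _ ((1 + d) * (1 + d * 3 ^+ p))).
  by rewrite ler_wpM2l//; lra.
have p1 : 1 <= 3 ^+ p :> R by rewrite exprn_ege1//; lra.
rewrite exprS; set q := 3 ^+ p in ih p1 *.
have dq0 : 0 <= d * q by rewrite mulr_ge0//; lra.
have : d * (d * q) <= 1 * (d * q) by rewrite ler_wpM2r.
have : d * 1 <= d * q by rewrite ler_wpM2l.
lra.
Qed.

Lemma exprn_near1 (a : R) p : 1 < a -> exists2 s : R, 1 < s & s ^+ p < a.
Proof.
move=> a1.
have q0 : 0 < 3 ^+ p :> R by rewrite exprn_gt0.
pose d := Num.min 1 ((a - 1) / 2 / 3 ^+ p).
have d0 : 0 < d by rewrite lt_min ltr01 divr_gt0//; lra.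
exists (1 + d); first lra.
apply: (@le_lt_trans _ _ (1 + d * 3 ^+ p)).
  by apply: bernoulli_upper; [exact: ltW|rewrite ge_min lexx].
have : d * 3 ^+ p <= (a - 1) / 2 by rewrite -ler_pdivlMr// ge_min lexx orbT.
lra.
Qed.

(** Otherwise a^n x <= U^(pn) x for all n, while the norms of the right-hand
    sides grow at most like s^(pn) with s^p < a. *)
Lemma subexponential_expand U (p : nat) (a : R) x : positive U -> subexponential U ->
  1 < a -> 0 <= x -> a *: x <= pow U p x -> x = 0.
Proof.
move=> U0 hU a1 x0 ax.
have [s s1 sa] := exprn_near1 p a1; have [K K0 hK] := hU s s1.
have pos n : positive (pow U n).
  by elim: n => //= n ih y y0; apply: U0; exact: ih.
have an n : a ^+ n *: x <= pow U (p * n) x.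
  rewrite powM; elim: n => [|n ih]; first by rewrite scale1r.
  apply: le_trans (positive_le (pos p) ih); rewrite linearZ/= exprSr -scalerA.
  by rewrite vle_scalel// exprn_ge0//; lra.
have a0 : 0 < a by lra.
have sp0 : 0 <= s ^+ p by rewrite exprn_ge0//; lra.
have q0 : 0 <= s ^+ p / a by rewrite divr_ge0// ltW.
have q1 : s ^+ p / a < 1 by rewrite ltr_pdivrMr// mul1r.
have K2 : 0 < (2 * K)^-1 by rewrite invr_gt0 mulr_gt0.
have [n hn] := exprn_small q0 q1 K2.
apply/eqP; rewrite -normr_le0.
have an0 : 0 < a ^+ n by rewrite exprn_gt0.
have : a ^+ n * `|x| <= K * (s ^+ p) ^+ n * `|x|.
  apply: (@le_trans _ _ `|pow U (p * n) x|); last by rewrite -exprM.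
  rewrite -{1}(ger0_norm (ltW an0)) -normrZ vle_norm_ge0//.
  by rewrite vscale_ge0// ltW.
have -> : (s ^+ p) ^+ n = (s ^+ p / a) ^+ n * a ^+ n by rewrite -exprMn divfK// gt_eqF.
have : K * (s ^+ p / a) ^+ n <= 2^-1.
  by rewrite mulrC -ler_pdivlMr// -invfM.
move=> h; rewrite !mulrA.
have ax0 : 0 <= a ^+ n * `|x| by rewrite mulr_ge0// ltW.
have := ler_wpM2r ax0 h => h1 h2.
have : a ^+ n * `|x| <= 0 by move: h1 h2; rewrite !mulrA; lra.
by rewrite pmulr_rle0.
Qed.

(** Where W = U^p exceeded the identity it would do so by a factor 1 + e on some
    subband, which W maps to itself. *)
Lemma commuting_le_id U V (p : nat) Q x : lattice_iso U V -> subexponential U ->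
  bproj Q ->
  (forall S, bproj S -> subproj S Q -> forall x, pow U p (S x) = S (pow U p x)) ->
  0 <= x -> pow U p (Q x) <= Q x.
Proof.
move=> iso hU hQ per x0; rewrite -[leRHS]add0r -vle_subl.
have [Up0 _ _ _] := lattice_iso_pow p iso; have [U0 _ _ _] := iso.
have y0 : 0 <= Q x by exact: bproj_ge0.
apply: (@vle0_arch _ _ _ (Q x)) => e e0; apply: contraT => nle.
have {nle} : ~~ (Q (pow U p x) <= Q ((1 + e) *: x)).
  move: nle; rewrite vle_subl linearZ/= scalerDl scale1r addrC.
  by rewrite per//; exact: subproj_refl.
move=> /(localize_le E_complete hQ)[S [hS SQ Sle Sne]].
exfalso; apply: Sne.
suff Sx : S x = 0 by rewrite -per// linearZ/= Sx linear0 scaler0.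
apply: (@subexponential_expand U p (1 + e)) => //; [lra|exact: bproj_ge0|].
by rewrite per// -linearZ.
Qed.

Lemma periodic_id U V (p : nat) Q : lattice_iso U V -> subexponential U ->
  subexponential V -> bproj Q ->
  (forall S, bproj S -> subproj S Q -> forall x, pow U p (S x) = S (pow U p x)) ->
  forall x, pow U p (Q x) = Q x.
Proof.
move=> iso hU hV hQ per.
have iso' := lattice_iso_sym iso.
have [Up0 Vp0 UV VU] := lattice_iso_pow p iso.
have per' S : bproj S -> subproj S Q -> forall x, pow V p (S x) = S (pow V p x).
  by move=> hS SQ x; rewrite -{1}(VU x) -per// UV.
have h x : 0 <= x -> pow U p (Q x) = Q x.
  move=> x0; apply/eqP; rewrite eq_le (commuting_le_id iso)//=.
  rewrite -{1}(VU (Q x)) positive_le//.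
  exact: (commuting_le_id iso').
by move=> x; rewrite -(vposB x) !linearB/= !h ?vpos_ge0.
Qed.
End periodicity.

(** * Sums of disjoint elements *)

Section disjoint_sums.
Local Open Scope complex_scope.
Context (R : realType) (E : banachLatticeType R).
Local Notation X := (complexification E).
Implicit Types (x y : E) (z : X) (Q : nat -> {linear E -> E}).

(** The norm of the complexification takes values in R[i]; this is its real
    value. *)
Definition nrm z : R := `|modulus z|.

Lemma nrm_ge0 z : 0 <= nrm z. Proof. exact: normr_ge0. Qed.

Lemma nrm_le z y : modulus z <= y -> nrm z <= `|y|.
Proof. by move=> h; apply: vle_norm_ge0 => //; exact: modulus_ge0. Qed.

Lemma nrm_eq0 z : nrm z = 0 -> z = 0.
Proof. by move=> /normr0_eq0/modulus_eq0. Qed.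

Lemma nrmD z w : nrm (z + w) <= nrm z + nrm w.
Proof. by apply: le_trans (ler_normD _ _); apply: nrm_le; exact: modulusD. Qed.

Lemma nrmB z w : nrm (z - w) <= nrm z + nrm w.
Proof. by apply: le_trans (ler_normD _ _); apply: nrm_le; exact: modulusBD. Qed.

Lemma modulusZr (a : R) z : modulus (a%:C *: z) = `|a| *: modulus z.
Proof. by rewrite modulusZ normc_def/= expr0n/= addr0 sqrtr_sqr. Qed.

Lemma nrmZr (a : R) z : nrm (a%:C *: z) = `|a| * nrm z.
Proof. by rewrite /nrm modulusZr normrZ normr_id. Qed.

Lemma modulus_sum n (x : nat -> X) :
  modulus (\sum_(k < n) x k) <= \sum_(k < n) modulus (x k).
Proof.
elim: n => [|n ih]; first by rewrite !big_ord0 modulus0.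
by rewrite !big_ord_recr/= (le_trans (modulusD _ _))// vleD2r.
Qed.

Lemma vsum_ge0 n (x : nat -> E) : (forall k, 0 <= x k) -> 0 <= \sum_(k < n) x k.
Proof. by move=> h; elim/big_rec: _ => // i y _ y0; rewrite vaddr_ge0. Qed.

Lemma vsum_le n (x y : nat -> E) : (forall k, (k < n)%N -> x k <= y k) ->
  \sum_(k < n) x k <= \sum_(k < n) y k.
Proof.
by move=> h; elim/big_rec2: _ => // i u v _ uv; rewrite vleD2 ?h.
Qed.

Definition disjoint_family n Q : Prop :=
  (forall k, bproj (Q k)) /\ forall i j, (i < j < n)%N -> forall x, Q i (Q j x) = 0.

Lemma disjoint_family_ne n Q i j : disjoint_family n Q -> (i < n)%N -> (j < n)%N ->
  i != j -> forall x, Q i (Q j x) = 0.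
Proof.
move=> [hQ dQ] ni nj; rewrite neq_ltn => /orP[ij|ji] x.
  by apply: dQ; rewrite ij.
by rewrite bproj_comm//; apply: dQ; rewrite ji.
Qed.

(** Each new band lies in the complement of the previous ones. *)
Lemma disjoint_family_sum_le n Q y : disjoint_family n Q -> 0 <= y ->
  \sum_(k < n) (Q k y : E) <= y.
Proof.
move=> dQ y0; elim: n dQ => [|n ih] dQ; first by rewrite big_ord0.
rewrite big_ord_recr/= addrC -vle_subr.
have {}ih : \sum_(k < n) (Q k y : E) <= y.
  apply: ih; split=> [|i j /andP[ij jn]]; first by case: dQ.
  by apply: (proj2 dQ); rewrite ij ltnW.
have -> : Q n y = Q n (y - \sum_(k < n) (Q k y : E)).
  rewrite linearB linear_sum big1 ?subr0// => k _.
  by apply: (disjoint_family_ne dQ); rewrite ?ltnS ?leqnn// ?(ltnW (ltn_ord k))//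
    neq_ltn ltn_ord orbT.
by apply: bproj_le_id; [case: dQ|rewrite vsub_ge0].
Qed.

Lemma disjoint_family_component n Q (x : nat -> X) j : disjoint_family n Q ->
  (forall k, cplx_op (Q k) (x k) = x k) -> (j < n)%N ->
  cplx_op (Q j) (\sum_(k < n) x k) = x j.
Proof.
move=> dQ xQ jn; rewrite linear_sum (bigD1 (Ordinal jn))//= xQ big1 ?addr0// => k kj.
rewrite -xQ /cplx_op/= !(disjoint_family_ne dQ)// ?ltn_ord//.
- by rewrite eq_sym; exact: kj.
- by rewrite eq_sym; exact: kj.
Qed.

Lemma disjoint_family_le n Q (x : nat -> X) j : disjoint_family n Q ->
  (forall k, cplx_op (Q k) (x k) = x k) -> (j < n)%N ->
  modulus (x j) <= modulus (\sum_(k < n) x k).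
Proof.
move=> dQ xQ jn; rewrite -(disjoint_family_component dQ xQ jn).
by rewrite modulus_bproj ?bproj_le_id ?modulus_ge0//; case: dQ.
Qed.

Lemma disjoint_family_modulus n Q (x : nat -> X) : disjoint_family n Q ->
  (forall k, cplx_op (Q k) (x k) = x k) ->
  \sum_(k < n) modulus (x k) <= modulus (\sum_(k < n) x k).
Proof.
move=> dQ xQ.
apply: le_trans (disjoint_family_sum_le dQ (modulus_ge0 (\sum_(k < n) x k))).
set s := modulus (\sum_(k < n) x k) in |- *.
have h k : (k < n)%N -> modulus (x k) <= Q k s.
  move=> kn; rewrite /s -modulus_bproj; last by case: dQ.
  by rewrite (disjoint_family_component dQ xQ kn).
exact: (vsum_le h).
Qed.

End disjoint_sums.

(** * Weighted automorphisms that are bounded below on every band *)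

Section weighted.
Local Open Scope complex_scope.
Context (R : realType) (E : banachLatticeType R).
Hypothesis E_complete : dedekind_complete E.
Local Notation X := (complexification E).
Implicit Types (x y : E) (z w : X) (P Q S : {linear E -> E}).

(** Like [localize_le], but on the largest band where the inequality is reversed,
    so that it holds on none of its nonzero subbands. *)
Lemma localize_gt x y : ~~ (x <= y) -> exists P, [/\ bproj P, nonzero P,
  P y <= P x & forall S, bproj S -> subproj S P -> S x <= S y -> forall u, S u = 0].
Proof.
move=> nle; have [P [hP Pf Psup]] := localize E_complete (x - y).
exists P; split=> //.
- exists (x - y); rewrite Pf => v0; move: nle; rewrite -vsub_ge0 -vleN2 oppr0 opprB.
  by rewrite -v0 le_vpos.
- by rewrite -vsub_ge0 -linearB Pf vpos_ge0.
- move=> S hS SP Sle; apply: Psup => //; apply/eqP; rewrite eq_le.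
  rewrite bproj_ge0 ?vpos_ge0// andbT -Pf (subproj_r _ hP hS SP) linearB.
  by rewrite vle_subl add0r.
Qed.

(** The trace left on the bands of X by a lower bound c |G y| <= |F y| for y in
    an almost localized subspace. *)
Definition bounded_below_on_bands (c : R) (F G : X -> X) : Prop :=
  forall P, bproj P -> nonzero P -> forall e : R, 0 < e ->
  exists z, [/\ cplx_op P z = z, z <> 0 & c * nrm (G z) <= nrm (F z) + e * nrm z].

Context (U V : {linear E -> E}) (iso : lattice_iso U V).
Hypotheses (hU : subexponential U) (hV : subexponential V).
Context (A T : {linear X -> X}) (C : R).
Hypotheses (C0 : 0 <= C) (A_central : central C A).
Hypothesis TE : forall z, T z = A (cplx_op U z).

Lemma modulus_pow n z : modulus (cplx_op (pow U n) z) = pow U n (modulus z).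
Proof. exact: lattice_iso_modulus (lattice_iso_pow n iso). Qed.

(** The central operator A_n with T^n = A_n U^n. *)
Definition weight n : {linear X -> X} := pow T n \o cplx_op (pow V n).

Lemma powT_weight n z : pow T n z = weight n (cplx_op (pow U n) z).
Proof.
have [_ _ UV _] := lattice_iso_pow n iso.
rewrite -[RHS]/(pow T n (cplx_op (pow V n) (cplx_op (pow U n) z))).
by congr (pow T n _); case: z => x y; rewrite /cplx_op/= !UV.
Qed.

Lemma powT_modulus n z : modulus (pow T n z) <= C ^+ n *: pow U n (modulus z).
Proof.
have [U0 _ _ _] := iso.
elim: n => [|n ih]; first by rewrite scale1r.
rewrite powS TE exprS -scalerA; apply: (le_trans (A_central _)).
rewrite vle_scalel// (lattice_iso_modulus _ iso).
by have := positive_le U0 ih; rewrite linearZ.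
Qed.

Lemma weight_central n : central (C ^+ n) (weight n).
Proof.
move=> z; apply: (le_trans (powT_modulus n (cplx_op (pow V n) z))).
have iso' := lattice_iso_sym (lattice_iso_pow n iso).
rewrite (lattice_iso_modulus _ iso').
by case: iso' => _ _ VU _; rewrite VU.
Qed.

Lemma transport_cplx_op n P z :
  cplx_op (transport (pow U n) (pow V n) P) (cplx_op (pow U n) z) =
  cplx_op (pow U n) (cplx_op P z).
Proof.
by have [_ _ UV _] := lattice_iso_pow n iso; rewrite /cplx_op/= !UV.
Qed.

Lemma powT_transport n P z : bproj P ->
  cplx_op (transport (pow U n) (pow V n) P) (pow T n z) = pow T n (cplx_op P z).
Proof.
move=> hP; have hC := transport_bproj (lattice_iso_pow n iso) hP.
by rewrite !powT_weight (central_bproj _ (weight_central n) hC) transport_cplx_op.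
Qed.

Lemma wandering_family m P : bproj P ->
  (forall j, (0 < j <= m)%N -> wandering (pow U j) P) ->
  disjoint_family m.+1 (fun k => transport (pow U k) (pow V k) P).
Proof.
move=> hP free; split=> [k|i j /andP[ij jm] x].
  exact: transport_bproj (lattice_iso_pow k iso) hP.
have [_ _ UV _] := lattice_iso_pow i iso.
rewrite !transportE -(subnKC (ltnW ij)) powD UV free ?linear0//.
by rewrite subn_gt0 ij/= (leq_trans (leq_subr _ _)).
Qed.

Definition polyT (a : nat -> R) n z : X := \sum_(k < n) (a k)%:C *: pow T k z.

(** The vectors T^k z, z in the band of P, live in the disjoint bands U^k P. *)
Lemma polyT_component m P a z k : bproj P -> cplx_op P z = z ->
  (forall j, (0 < j <= m)%N -> wandering (pow U j) P) -> (k <= m)%N ->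
  `|a k| *: modulus (pow T k z) <= modulus (polyT a m.+1 z).
Proof.
move=> hP Pz free km; rewrite -modulusZr.
apply: (disjoint_family_le (x := fun k => (a k)%:C *: pow T k z)
  (wandering_family hP free)) => // j.
by rewrite linearZ/= powT_transport// Pz.
Qed.

Lemma polyT_modulus m P (a : nat -> R) z : bproj P -> cplx_op P z = z ->
  (forall j, (0 < j <= m)%N -> wandering (pow U j) P) ->
  \sum_(k < m.+1) `|a k| *: modulus (pow T k z) <= modulus (polyT a m.+1 z).
Proof.
move=> hP Pz free.
have h k : cplx_op (transport (pow U k) (pow V k) P) ((a k)%:C *: pow T k z) =
    (a k)%:C *: pow T k z.
  by rewrite linearZ/= powT_transport// Pz.
have := disjoint_family_modulus (wandering_family hP free) h.
by under eq_bigr do rewrite modulusZr.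
Qed.

Lemma polyT_telescope a n z : polyT a n.+1 z - T (polyT a n.+1 z) =
  (a 0)%:C *: z + \sum_(k < n) (a k.+1 - a k)%:C *: pow T k.+1 z
  - (a n)%:C *: pow T n.+1 z.
Proof.
rewrite /polyT linear_sum/=.
under [X in _ - X]eq_bigr do rewrite linearZ/= -powS.
rewrite big_ord_recl [X in _ - X]big_ord_recr/= opprD addrA; congr (_ - _).
rewrite -addrA; congr (_ + _); rewrite -sumrB; apply: eq_bigr => k _.
by rewrite -scalerBl -rmorphB.
Qed.

Lemma polyT_defect (a : nat -> R) n z (d : R) :
  0 <= d -> (forall k, (k < n)%N -> `|a k.+1 - a k| <= d * `|a k.+1|) ->
  modulus (polyT a n.+1 z - T (polyT a n.+1 z)) <=
  d *: (\sum_(k < n.+1) `|a k| *: modulus (pow T k z)) + `|a 0| *: modulus z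
  + `|a n| *: modulus (pow T n.+1 z).
Proof.
move=> d0 ad; rewrite polyT_telescope; apply: (le_trans (modulusBD _ _)).
rewrite modulusZr vleD2r; apply: (le_trans (modulusD _ _)).
rewrite modulusZr addrC vleD2r.
set b := fun k => (a k.+1 - a k)%:C *: pow T k.+1 z.
apply: (le_trans (modulus_sum n b)).
have h k : (k < n)%N -> modulus (b k) <= d *: (`|a k.+1| *: modulus (pow T k.+1 z)).
  by move=> kn; rewrite modulusZr scalerA vscale_le_l ?modulus_ge0 ?ad.
apply: (le_trans (vsum_le h)); rewrite -scaler_sumr.
rewrite big_ord_recl; apply: vle_scalel => //.
by apply: vle_addl; rewrite vscale_ge0 ?normr_ge0// modulus_ge0.
Qed.

(** The contradiction comes from q, the sum of a_j T^j z with
    a_j = rho^|j - N| and z in V^N Q.  Passing from a_j to a_(j+1) changes a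
    coefficient by a relative amount at most c/4, so q - T q is at most
    (c/4) |q| plus the two boundary terms rho^N z and rho^N T^(2N+1) z.  By the
    lower bound for A_N on Q the norm of z is at most 8 k^2 times that of
    T^N z, and by the upper bound on U^N Q that of T^(2N+1) z is at
    most 4 t k^2 times that of T^N z; as rho^N k^2 is small and |T^N z| <= |q|,
    the boundary terms add at most another (c/4) |q|. *)
Lemma no_wandering_band N Q (k t c rho : R) : bproj Q -> nonzero Q ->
  (forall j, (0 < j <= N + N)%N -> wandering (pow U j) Q) ->
  0 < k -> (forall x, `|pow U N x| <= k * `|x|) ->
  (forall x, `|pow V N x| <= k * `|x|) ->
  0 <= t -> (forall z, nrm (T z) <= t * nrm z) ->
  (forall w, (8 * k)^-1 *: Q (modulus w) <= Q (modulus (weight N w))) ->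
  (forall w, transport (pow U N) (pow V N) Q (modulus (weight N w)) <=
     (4 * k) *: transport (pow U N) (pow V N) Q (modulus w)) ->
  0 < c -> rho = (1 + c / 4)^-1 -> rho ^+ N * (k ^+ 2 * (8 + 4 * t)) <= c / 4 ->
  (forall a n, bounded_below_on_bands c
     (fun z => polyT a n z - T (polyT a n z)) (polyT a n)) ->
  False.
Proof.
move=> hQ nzQ free k0 Uk Vk t0 Tt low up c0 rhoE small HY.
have isoN := lattice_iso_pow N iso; have isoN' := lattice_iso_sym isoN.
have [UN0 VN0 UV VU] := isoN.
set P := transport (pow V N) (pow U N) Q.
have hP : bproj P := transport_bproj isoN' hQ.
have QE x : transport (pow U N) (pow V N) P x = Q x by exact: transportK isoN'.
have nzP : nonzero P.
  case: nzQ => x Qx; exists (pow V N x); rewrite transportE VU => e.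
  by apply: Qx; rewrite -[LHS]VU e linear0.
have freeP j : (0 < j <= N + N)%N -> wandering (pow U j) P.
  move=> /free h x; rewrite !transportE.
  have -> y : pow U N (pow U j (pow V N y)) = pow U j y.
    by rewrite -powD addnC powD VU.
  by rewrite h linear0.
pose a j : R := rho ^+ ((N - j) + (j - N)).
have rho0 : 0 < rho by rewrite rhoE invr_gt0; lra.
have rhoM : rho * (1 + c / 4) = 1 by rewrite rhoE mulVf// gt_eqF//; lra.
have a0 j : 0 <= a j by rewrite exprn_ge0// ltW.
have aN : a N = 1 by rewrite /a subnn addn0.
have adiff j : (j < N + N)%N -> `|a j.+1 - a j| <= c / 4 * `|a j.+1|.
  move=> _; rewrite (ger0_norm (a0 _)).
  have [jN|Nj] := ltnP j N.
    have -> : a j = rho * a j.+1.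
      rewrite -exprS; congr (_ ^+ _).
      by lia.
    have := a0 j.+1; set b := a j.+1 => b0.
    have rb : rho * b <= b by have := mulr_ge0 (ltW rho0) b0; 
      have := mulr_ge0 (mulr_ge0 (ltW rho0) (ltW c0)) b0; have := congr1 ( *%R^~ b) rhoM; lra.
    rewrite ger0_norm ?subr_ge0//.
    have := congr1 ( *%R^~ b) rhoM => /=.
    have := ler_wpM2l (ltW c0) rb.
    lra.
  have aS : a j.+1 = rho * a j.
    rewrite -exprS; congr (_ ^+ _).
    by lia.
  have := a0 j; rewrite aS; set b := a j => b0.
  rewrite distrC ger0_norm.
    by have := congr1 ( *%R^~ b) rhoM => /=; lra.
  have := mulr_ge0 (mulr_ge0 (ltW rho0) (ltW c0)) b0.
  by have := congr1 ( *%R^~ b) rhoM => /=; lra.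
pose e := c / (32 * k ^+ 2).
have e0 : 0 < e by rewrite divr_gt0// mulr_gt0// exprn_gt0.
have [z [Pz z0 Hz]] := HY a (N + N).+1 P hP nzP e e0.
set q := polyT a (N + N).+1 z in Hz.
pose u := nrm (pow T N z).
have wQ : cplx_op Q (cplx_op (pow U N) z) = cplx_op (pow U N) z.
  by rewrite -{2}Pz -transport_cplx_op; apply: eq_cplx_op => x; rewrite QE.
have zu : nrm z <= 8 * k ^+ 2 * u.
  have := low (cplx_op (pow U N) z).
  rewrite -(modulus_bproj _ hQ) wQ -(modulus_bproj _ hQ).
  rewrite (central_bproj _ (weight_central N) hQ) wQ -powT_weight modulus_pow.
  move=> h; have : `|(8 * k)^-1 *: pow U N (modulus z)| <= u.
    apply: vle_norm_ge0 h; apply: vscale_ge0; first by rewrite invr_ge0 mulr_ge0// ltW.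
    by apply: UN0; exact: modulus_ge0.
  rewrite normrZ gtr0_norm ?invr_gt0 ?mulr_gt0// ler_pdivrMl ?mulr_gt0// => h2.
  have := Vk (pow U N (modulus z)); rewrite UV => /le_trans; apply.
  apply: (le_trans (ler_wpM2l (ltW k0) h2)).
  by rewrite expr2 !mulrA ler_wpM2r ?nrm_ge0//; lra.
have TQ : cplx_op Q (pow T N z) = pow T N z.
  by rewrite -{2}Pz -powT_transport//; apply: eq_cplx_op => x; rewrite QE.
pose tQ := transport (pow U N) (pow V N) Q.
have htQ : bproj tQ := transport_bproj isoN hQ.
have TTu : nrm (pow T (N + N) z) <= 4 * k ^+ 2 * u.
  rewrite powD powT_weight; set v := cplx_op (pow U N) _.
  have vQ : cplx_op tQ v = v by rewrite transport_cplx_op TQ.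
  have := up v; rewrite -(modulus_bproj _ htQ) -(modulus_bproj _ htQ).
  rewrite (central_bproj _ (weight_central N) htQ) vQ => /nrm_le /le_trans; apply.
  rewrite normrZ gtr0_norm ?mulr_gt0// modulus_pow.
  apply: (le_trans (ler_wpM2l _ (Uk _))); first by rewrite mulr_ge0// ltW.
  by rewrite expr2 !mulrA ler_wpM2r ?nrm_ge0//; lra.
have qu : u <= nrm q.
  have := polyT_component a hP Pz freeP (leq_addr N N).
  by rewrite aN normr1 scale1r => /nrm_le.
(* a 0 and a (N + N) equal rho ^+ N. *)
have defect : nrm (q - T q) <= c / 4 * nrm q + rho ^+ N * nrm z +
   rho ^+ N * nrm (pow T (N + N).+1 z).
  have c4 : 0 <= c / 4 by lra.
  apply: (le_trans (nrm_le (polyT_defect _ c4 adiff))).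
  have an : a (N + N)%N = rho ^+ N.
    by rewrite /a addnK (_ : N - (N + N) = 0)%N// subnDA subnn.
  have a00 : a 0 = rho ^+ N by rewrite /a subn0 addn0.
  rewrite a00 an gtr0_norm ?exprn_gt0//.
  apply: (le_trans (ler_normD _ _)); rewrite normrZ gtr0_norm ?exprn_gt0// lerD2r.
  apply: (le_trans (ler_normD _ _)); apply: lerD; last first.
    by rewrite normrZ gtr0_norm ?exprn_gt0.
  rewrite normrZ (ger0_norm c4) ler_wpM2l//.
  pose b j := `|a j| *: modulus (pow T j z).
  have b0 j : 0 <= b j by rewrite vscale_ge0// modulus_ge0.
  exact: (vle_norm_ge0 (vsum_ge0 _ b0) (polyT_modulus a hP Pz freeP)).
have u0 : 0 <= u := nrm_ge0 _.
have T1 : nrm (pow T (N + N).+1 z) <= t * (4 * k ^+ 2 * u).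
  by apply: (le_trans (Tt _)); rewrite ler_wpM2l.
have rN : 0 <= rho ^+ N by rewrite exprn_ge0// ltW.
have s1 := ler_wpM2l rN zu; have s2 := ler_wpM2l rN T1.
have s3 := ler_wpM2r u0 small.
have s4 : e * nrm z <= c / 4 * u.
  apply: (le_trans (ler_wpM2l (ltW e0) zu)).
  have ek : e * (32 * k ^+ 2) = c.
    by rewrite divfK// gt_eqF// mulr_gt0// exprn_gt0.
  by have := congr1 ( *%R^~ u) ek => /=; lra.
have s5 : c * u <= c * nrm q by rewrite ler_wpM2l// ltW.
have cu : c * u <= 0 by lra.
have {cu}u_0 : u = 0.
  by apply/eqP; rewrite eq_le u0 andbT -(pmulr_rle0 _ c0).
apply: z0; apply: nrm_eq0; apply/eqP; rewrite eq_le nrm_ge0 andbT.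
by move: zu; rewrite u_0 mulr0.
Qed.

(** For q = z + T z + ... + T^(p-1) z, the difference q - T q = z - T^p z is
    (1 - A_p) z, since U^p z = z; it is small compared with |z| <= |q|. *)
Lemma no_periodic_band p Q (c : R) : bproj Q -> nonzero Q ->
  (0 < p)%N -> (forall j, (0 < j < p)%N -> wandering (pow U j) Q) ->
  (forall x, pow U p (Q x) = Q x) ->
  (forall w, Q (modulus (w - weight p w)) <= (c / 4) *: Q (modulus w)) ->
  0 < c ->
  (forall a n, bounded_below_on_bands c
     (fun z => polyT a n z - T (polyT a n z)) (polyT a n)) ->
  False.
Proof.
case: p => // p hQ nzQ _ free per near c0 HY.
have c4 : 0 < c / 4 by lra.
have [z [Qz z0]] := HY (fun=> 1) p.+1 Q hQ nzQ _ c4.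
set q := polyT _ _ z => Hz.
have qz : nrm z <= nrm q.
  have := polyT_component (fun=> 1) hQ Qz free (leq0n p).
  by rewrite normr1 scale1r => /nrm_le.
have Uz : cplx_op (pow U p.+1) z = z.
  by rewrite -[in LHS]Qz; rewrite -[in RHS]Qz; case: (z) => u v; rewrite /cplx_op/= -!powS !per.
have defect : nrm (q - T q) <= c / 4 * nrm z.
  rewrite /q polyT_telescope big1 => [|k _]; last by rewrite subrr scale0r.
  rewrite addr0 !scale1r powT_weight Uz.
  have := near z; rewrite -(modulus_bproj _ hQ) -(modulus_bproj z hQ) linearB/=.
  rewrite (central_bproj _ (weight_central p.+1) hQ) Qz => /nrm_le /le_trans; apply.
  by rewrite normrZ gtr0_norm.
apply: z0; apply: nrm_eq0; apply/eqP; rewrite eq_le nrm_ge0 andbT.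
have := ler_wpM2l (ltW c0) qz; rewrite -(pmulr_rle0 _ c0); lra.
Qed.

(** On a band where the inequality is strictly reversed, each term of the sum on
    the right is at most |x|.  The terms in x - T^p x make A_p close to 1 on
    a periodic band; the term in U^N bounds A_N from below, because
    |A_N U^N x| = |T^N x| >= |x| - |x - T^N x|, and the term in V^N bounds it
    from above. *)
Lemma modulus_le_defects N (k t c rho : R) :
  0 < k -> (forall x, `|pow U N x| <= k * `|x|) ->
  (forall x, `|pow V N x| <= k * `|x|) ->
  0 <= t -> (forall z, nrm (T z) <= t * nrm z) ->
  0 < c -> rho = (1 + c / 4)^-1 -> rho ^+ N * (k ^+ 2 * (8 + 4 * t)) <= c / 4 ->
  (forall a n, bounded_below_on_bands c
     (fun z => polyT a n z - T (polyT a n z)) (polyT a n)) ->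
  forall x : X, modulus x <= \sum_(p < N + N) (4 / c) *: modulus (x - pow T p.+1 x)
     + modulus (x - pow T N x)
     + (4 * k)^-1 *: pow U N (modulus x) + (4 * k)^-1 *: pow V N (modulus (pow T N x)).
Proof.
move=> k0 Uk Vk t0 Tt c0 rhoE small HY x; apply: contraT.
set a1 := \sum_(_ < _) _; set a2 := modulus (x - pow T N x).
set a3 := _ *: pow U N _; set a4 := _ *: pow V N _.
have [UN0 VN0 UV VU] := lattice_iso_pow N iso.
have k4 : 0 <= (4 * k)^-1 by rewrite invr_ge0 mulr_ge0// ltW.
have c4 : 0 <= 4 / c by rewrite divr_ge0// ltW.
pose f p := (4 / c) *: modulus (x - pow T p.+1 x).
have f0 p : 0 <= f p by rewrite vscale_ge0// modulus_ge0.
have a10 : 0 <= a1 by exact: (vsum_ge0 _ f0).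
have a20 : 0 <= a2 := modulus_ge0 _.
have a30 : 0 <= a3 by rewrite vscale_ge0// UN0// modulus_ge0.
have a40 : 0 <= a4 by rewrite vscale_ge0// VN0// modulus_ge0.
move=> /localize_gt[P [hP nzP Ple Psup]].
have [Q [hQ QP nzQ Qcase]] := wandering_or_periodic (N + N) iso hP nzP.
have Q_P y : Q (P y) = Q y := subproj_r y hP hQ QP.
have Qle b : 0 <= b -> b <= a1 + a2 + a3 + a4 -> Q b <= Q (modulus x).
  move=> b0 ba; apply: (le_trans (bproj_le hQ ba)).
  by rewrite -(Q_P (modulus x)) -Q_P bproj_le.
have Qsup S : bproj S -> subproj S Q -> S (modulus x) <= S (a1 + a2 + a3 + a4) ->
    forall y, S y = 0.
  by move=> hS SQ; apply: Psup => //; exact: subproj_trans QP.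
have wuQ : weak_unit Q (modulus x).
  move=> S hS SQ Sx; apply: (Qsup S hS SQ); rewrite Sx bproj_ge0//.
  by rewrite !vaddr_ge0.
exfalso; case: Qcase => [free|[p [/andP[p0 pm] free per]]]; last first.
  have perid := periodic_id E_complete iso hU hV hQ per.
  have perQ y : pow U p (Q y) = Q (pow U p y) by apply: per => //; exact: subproj_refl.
  apply: (@no_periodic_band p Q c) => //.
  pose B : {linear X -> X} := idfun \- weight p.
  have BE w : B w = w - weight p w by [].
  have Bc : central (1 + C ^+ p) B.
    move=> w; rewrite BE; apply: (le_trans (modulusBD _ _)).
    by rewrite scalerDl scale1r vleDl weight_central.
  have C1 : 0 <= 1 + C ^+ p by rewrite addr_ge0// exprn_ge0.
  have c40 : 0 <= c / 4 by lra.
  apply: (central_le E_complete C1 c40 Bc hQ wuQ).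
  have -> : Q (modulus (B x)) = Q (modulus (x - pow T p x)).
    rewrite -!(modulus_bproj _ hQ) BE !linearB/=; congr (modulus (_ - _)).
    rewrite powT_weight !(central_bproj _ (weight_central p) hQ).
    congr (weight p _); case: (x) => u v; rewrite /cplx_op/=.
    by rewrite -!perQ !perid.
  have : Q (f p.-1) <= Q (modulus x).
    apply: Qle => //; rewrite -!addrA -[leLHS]addr0 vleD2//; last by rewrite !vaddr_ge0.
    have pN : (p.-1 < N + N)%N by rewrite prednK.
    rewrite /a1 (bigD1 (Ordinal pN))//= -[leLHS]addr0 vleDl.
    by elim/big_rec: _ => // i u _ u0; rewrite vaddr_ge0// f0.
  rewrite /f prednK// linearZ/= => /(vle_scalel c40).
  by rewrite scalerA mulrA divfK ?gt_eqF// divff ?scale1r//; lra.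
pose u := cplx_op (pow U N) x.
have uE : modulus u = pow U N (modulus x) by rewrite modulus_pow.
have Tu : weight N u = pow T N x by rewrite powT_weight.
have a3E : a3 = (4 * k)^-1 *: modulus u by rewrite uE.
apply: (@no_wandering_band N Q k t c rho) => //.
- have ck : (8 * k)^-1 < (4 * k)^-1.
    by rewrite ltf_pV2 ?posrE ?mulr_gt0// ltr_pM2r//; lra.
  apply: (central_ge E_complete (exprn_ge0 N C0) _ ck (weight_central N) hQ (u := u)).
  + by rewrite invr_ge0 mulr_ge0// ltW.
  + move=> S hS SQ Su; apply: (Qsup S hS SQ).
    have Tx0 : S (modulus (pow T N x)) = 0.
      apply/eqP; rewrite eq_le bproj_ge0 ?modulus_ge0// andbT -Tu.
      by apply: (le_trans (bproj_le hS (weight_central N u))); rewrite linearZ/= Su scaler0.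
    apply: (le_trans (bproj_le hS (modulus_triangle x (pow T N x)))).
    rewrite linearD/= Tx0 addr0 bproj_le// -/a2.
    by rewrite -!addrA addrCA -[leLHS]addr0 vleD2// !vaddr_ge0.
  + rewrite Tu.
    have : Q (a2 + a3) <= Q (modulus x).
      apply: Qle; first by rewrite vaddr_ge0.
      by rewrite -!addrA [leRHS]addrC -!addrA vleDl -[leLHS]addr0 vleDl vaddr_ge0.
    move=> /le_trans /(_ (bproj_le hQ (modulus_triangle x (pow T N x)))).
    by rewrite !linearD/= vleDl a3E linearZ.
- have isoN := lattice_iso_pow N iso.
  have htQ := transport_bproj isoN hQ.
  have k40 : 0 <= 4 * k by rewrite mulr_ge0// ltW.
  apply: (central_le E_complete (exprn_ge0 N C0) k40 (weight_central N) htQ (u := u)).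
    by rewrite uE; exact: transport_weak_unit.
  rewrite Tu uE !transportE UV -linearZ/= positive_le//.
  have : Q a4 <= Q (modulus x).
    by apply: Qle => //; rewrite addrC -[leLHS]addr0 vleDl !vaddr_ge0.
  rewrite linearZ/= => /(vle_scalel k40).
  by rewrite scalerA divff ?scale1r// gt_eqF// mulr_gt0.
Qed.

Lemma operator_bounds : exists K t : R, [/\ 0 < K, forall x, `|U x| <= K * `|x|,
  forall x, `|V x| <= K * `|x|, 0 <= t & forall z, nrm (T z) <= t * nrm z].
Proof.
have s1 : 1 < 2 :> R by lra.
have [K1 K10 h1] := hU s1; have [K2 K20 h2] := hV s1.
pose K := (K1 + K2) * 2.
have KU x : `|U x| <= K * `|x|.
  by apply: (le_trans (h1 1%N x)); rewrite expr1 ler_wpM2r// /K; lra.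
exists K, (C * K); split=> //.
- by rewrite /K; lra.
- by move=> x; apply: (le_trans (h2 1%N x)); rewrite expr1 ler_wpM2r// /K; lra.
- by rewrite mulr_ge0// /K; lra.
move=> z; have := powT_modulus 1 z; rewrite expr1 => /nrm_le /le_trans; apply.
by rewrite normrZ ger0_norm// -mulrA ler_wpM2l// KU.
Qed.

Lemma pow_difference (t : R) n z : 0 <= t -> (forall z, nrm (T z) <= t * nrm z) ->
  nrm (z - pow T n z) <= (\sum_(i < n) t ^+ i) * nrm (z - T z).
Proof.
move=> t0 Tt; elim: n => [|n ih].
  by rewrite big_ord0 mul0r subrr /nrm modulus0 normr0.
have -> : z - pow T n.+1 z = (z - pow T n z) + pow T n (z - T z).
  by rewrite linearB/= -powSr addrA subrK.
apply: (le_trans (nrmD _ _)); rewrite big_ord_recr/= mulrDl lerD//.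
elim: n {ih} (z - T z) => [|n ih] w; first by rewrite expr0 mul1r.
by rewrite powS (le_trans (Tt _))// exprS -mulrA ler_wpM2l.
Qed.

(** N is chosen so that rho^N k^2 is small, where k = K s^N bounds U^N and V^N
    and rho = 1 / (1 + c/4): any s > 1 with s^2 < 1 + c/4 will do. *)
Lemma bounded_below_id_sub (c : R) : 0 < c ->
  (forall a n, bounded_below_on_bands c
     (fun z => polyT a n z - T (polyT a n z)) (polyT a n)) ->
  exists2 c' : R, 0 < c' & forall z, c' * nrm z <= nrm (z - T z).
Proof.
move=> c0 HY; have [_ [t [_ _ _ t0 Tt]]] := operator_bounds.
have a1 : 1 < 1 + c / 4 by lra.
have [s s1 sa] := exprn_near1 2 a1.
have [K1 K10 h1] := hU s1; have [K2 K20 h2] := hV s1.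
pose K := K1 + K2; have K0 : 0 < K by rewrite /K; lra.
pose rho := (1 + c / 4)^-1.
have rho0 : 0 < rho by rewrite invr_gt0; lra.
pose M := K ^+ 2 * (8 + 4 * t).
have M0 : 0 < M by rewrite mulr_gt0 ?exprn_gt0//; lra.
have q0 : 0 <= rho * s ^+ 2 by rewrite mulr_ge0 ?exprn_ge0 ?(ltW rho0)//; lra.
have q1 : rho * s ^+ 2 < 1 by rewrite mulrC ltr_pdivrMr; lra.
have cM : 0 < c / 4 / M by rewrite divr_gt0//; lra.
have [N hN] := exprn_small q0 q1 cM.
pose k := K * s ^+ N.
have sN : 0 < s ^+ N by rewrite exprn_gt0//; lra.
have k0 : 0 < k by rewrite mulr_gt0.
have Uk x : `|pow U N x| <= k * `|x|.
  by apply: (le_trans (h1 N x)); rewrite ler_wpM2r// ler_pM2r// /K; lra.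
have Vk x : `|pow V N x| <= k * `|x|.
  by apply: (le_trans (h2 N x)); rewrite ler_wpM2r// ler_pM2r// /K; lra.
have small : rho ^+ N * (k ^+ 2 * (8 + 4 * t)) <= c / 4.
  have -> : rho ^+ N * (k ^+ 2 * (8 + 4 * t)) = (rho * s ^+ 2) ^+ N * M.
    have e2 : (s ^+ N) ^+ 2 = (s ^+ 2) ^+ N by rewrite -!exprM mulnC.
    rewrite /k /M [(K * _) ^+ 2]exprMn e2 [(rho * _) ^+ N]exprMn.
    by set y := _ ^+ 2 ^+ N; set r := rho ^+ N; ring.
  by rewrite -ler_pdivlMr.
have main := modulus_le_defects k0 Uk Vk t0 Tt c0 erefl small HY.
pose L n := \sum_(i < n) t ^+ i.
have L0 n : 0 <= L n by apply: sumr_ge0 => i _; exact: exprn_ge0.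
pose D := \sum_(p < N + N) 4 / c * L p.+1 + 2 * L N + 1.
have D1 : 1 <= D.
  have : 0 <= \sum_(p < N + N) 4 / c * L p.+1.
    by apply: sumr_ge0 => i _; rewrite mulr_ge0// divr_ge0// ltW.
  by have := L0 N; rewrite /D; lra.
exists (2 * D)^-1; first by rewrite invr_gt0; lra.
move=> z; rewrite ler_pdivrMl; last by lra.
have := nrm_le (main z).
set d := nrm (z - T z).
have d0 : 0 <= d := nrm_ge0 _.
have b1 : `|\sum_(p < N + N) (4 / c) *: modulus (z - pow T p.+1 z)| <=
    (\sum_(p < N + N) 4 / c * L p.+1) * d.
  apply: (le_trans (ler_norm_sum _ _ _)); rewrite mulr_suml ler_sum// => p _.
  rewrite normrZ ger0_norm ?divr_ge0 ?(ltW c0)// -mulrA ler_wpM2l ?divr_ge0 ?(ltW c0)//.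
  exact: pow_difference.
have b2 : nrm (z - pow T N z) <= L N * d by exact: pow_difference.
have k4 : (4 * k)^-1 * k = 4^-1 by rewrite invfM -mulrA mulVf ?mulr1// gt_eqF.
have k40 : 0 <= (4 * k)^-1 by rewrite invr_ge0 mulr_ge0// ltW.
have b3 : `|(4 * k)^-1 *: pow U N (modulus z)| <= 4^-1 * nrm z.
  by rewrite normrZ ger0_norm// -k4 -mulrA ler_wpM2l.
have b4 : `|(4 * k)^-1 *: pow V N (modulus (pow T N z))| <= 4^-1 * (nrm z + L N * d).
  rewrite normrZ ger0_norm// -k4 -mulrA ler_wpM2l//; apply: (le_trans (Vk _)).
  rewrite ler_pM2l//; apply: le_trans (lerD (lexx _) b2).
  by rewrite -[X in nrm X <= _](subKr z) nrmB.
move=> /le_trans h.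
have {}h := h _ (le_trans (ler_normD _ _) (lerD (le_trans (ler_normD _ _) (lerD
  (le_trans (ler_normD _ _) (lerD b1 b2)) b3)) b4)).
move: h; rewrite /D; have := mulr_ge0 (L0 N) d0; lra.
Qed.

(** On a band where |T x| = |A U x| is much smaller than |U x|, the operator A
    is small; its preimage under U is then a band on which T is small. *)
Lemma bounded_below_weighted (c : R) : 0 < c -> bounded_below_on_bands c T id ->
  exists2 c' : R, 0 < c' & forall z, c' * nrm z <= nrm (T z).
Proof.
move=> c0 HY; have [K [_ [K0 KU KV _ _]]] := operator_bounds.
have [U0 V0 UV VU] := iso.
pose D := 4 * K / c.
have D0 : 0 < D by rewrite divr_gt0// mulr_gt0.
have Di0 : 0 <= D^-1 by rewrite invr_ge0 ltW.
have main z : U (modulus z) <= D *: modulus (T z).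
  apply: contraT => /localize_gt[P [hP nzP Ple Psup]]; exfalso.
  have uE : modulus (cplx_op U z) = U (modulus z) := lattice_iso_modulus z iso.
  have Ale : forall w, P (modulus (A w)) <= D^-1 *: P (modulus w).
    apply: (central_le E_complete C0 Di0 A_central hP (u := cplx_op U z)).
      move=> S hS SP; rewrite uE => SU; apply: Psup => //.
      by rewrite SU linearZ/= vscale_ge0 ?(ltW D0)// bproj_ge0// modulus_ge0.
    rewrite uE -TE; have := vle_scalel Di0 Ple.
    by rewrite linearZ/= scalerA mulVf ?scale1r// gt_eqF.
  have isoV := lattice_iso_sym iso.
  have nzQ : nonzero (transport V U P).
    case: nzP => x Px; exists (V x); rewrite transportE VU => e.
    by apply: Px; rewrite -[LHS]VU e linear0.
  have c4 : 0 < c / 4 by lra.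
  have [w [Qw w0 Hw]] := HY _ (transport_bproj isoV hP) nzQ _ c4.
  have PU : cplx_op P (cplx_op U w) = cplx_op U w.
    by rewrite -[in RHS]Qw /cplx_op/= !VU.
  have Tw : nrm (T w) <= c / 4 * nrm w.
    have := Ale (cplx_op U w).
    rewrite -(modulus_bproj _ hP) -(modulus_bproj _ hP) (central_bproj _ A_central hP).
    rewrite PU -TE (lattice_iso_modulus _ iso) => /nrm_le /le_trans; apply.
    rewrite normrZ ger0_norm//; apply: (le_trans (ler_wpM2l Di0 (KU _))).
    have DK : D^-1 * K = c / 4 by rewrite /D; field; rewrite !gt_eqF.
    by rewrite mulrA DK.
  apply: w0; apply: nrm_eq0; apply/eqP; rewrite eq_le nrm_ge0 andbT.
  by rewrite -(pmulr_rle0 _ c0); move: Hw Tw => /=; lra.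
exists (K * D)^-1; first by rewrite invr_gt0 mulr_gt0.
move=> z; rewrite ler_pdivrMl; last exact: mulr_gt0.
rewrite -(mulrA K D).
have := KV (U (modulus z)); rewrite UV => /le_trans; apply.
rewrite ler_pM2l// -(ger0_norm (ltW D0)) -normrZ.
by apply: vle_norm_ge0 => //; apply: U0; exact: modulus_ge0.
Qed.

End weighted.

(** * Positive operators with unimodular spectrum *)

Section real_operators.
Local Open Scope complex_scope.
Context (R : realType) (E : banachLatticeType R).
Local Notation X := (complexification E).
Local Notation C := (R[i]).
Implicit Types (x y : E) (z w : X) (P Q S : {linear E -> E}).
Context (U : {linear X -> X}).

Lemma complexE (l : C) : 0 <= l -> l = (complex.Re l)%:C.
Proof. by move=> l0; rewrite RRe_real// ger0_real. Qed.

Lemma nrmE z : `|z| = (nrm z)%:C. Proof. by []. Qed.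

Lemma nrm_real x : nrm (Cplx x 0) = `|x|.
Proof. by rewrite /nrm modulus_real norm_vabs. Qed.

Lemma nrm_cre z : `|cre z| <= nrm z.
Proof. by rewrite -lecR; exact: norm_cre. Qed.

Lemma nrmZ (l : C) z : nrm (l *: z) = complex.Re `|l| * nrm z.
Proof. by rewrite /nrm modulusZ normrZ ger0_norm ?absC_ge0. Qed.

Definition real_part (V : {linear X -> X}) x : E := cre (V (Cplx x 0)).

Fact real_part_linear V : linear (real_part V).
Proof.
move=> a x y; rewrite /real_part.
have -> : Cplx (a *: x + y) 0 = a%:C *: Cplx x 0 + Cplx y 0.
  have e : a%:C *: Cplx x 0 = Cplx (a *: x - 0 *: 0) (a *: 0 + 0 *: x) by [].
  rewrite e !scaler0 scale0r subr0 addr0.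
  have -> (u v : E) : Cplx u 0 + Cplx v 0 = Cplx (u + v) (0 + 0) by [].
  by rewrite addr0.
by rewrite linearD linearZ creD creZ/= scale0r subr0.
Qed.

HB.instance Definition _ V :=
  GRing.isLinear.Build R E E *:%R (real_part V) (real_part_linear V).

Let Ur : {linear E -> E} := real_part U.

Hypothesis U_pos : positive_operator U.

Lemma real_part_positive : positive Ur.
Proof. by move=> x /U_pos[y y0 e]; rewrite /Ur/= /real_part e. Qed.

Lemma real_operatorE z : U z = cplx_op Ur z.
Proof.
have pos x : 0 <= x -> U (Cplx x 0) = Cplx (Ur x) 0.
  by move=> x0; rewrite /Ur/= /real_part; have [y _ ->] := U_pos x0.
have CB (u v : E) : Cplx u 0 - Cplx v 0 = Cplx (u - v) (0 - 0) by [].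
have re x : U (Cplx x 0) = Cplx (Ur x) 0.
  have e : Cplx x 0 = Cplx (vpos x) 0 - Cplx (vpos (- x)) 0.
    by rewrite CB vposB subr0.
  rewrite e linearB/= !pos ?vpos_ge0// CB subr0 -linearB.
  by rewrite vposB.
case: z => x y.
have e (u v : E) : Cplx u v = Cplx u 0 + 'i%C *: Cplx v 0.
  have h : 'i%C *: Cplx v 0 = Cplx (0 *: v - 1 *: 0) (0 *: 0 + 1 *: v) by [].
  rewrite h !scaler0 scale0r subr0 scale1r add0r.
  have -> : Cplx u 0 + Cplx 0 v = Cplx (u + 0) (0 + v) by [].
  by rewrite addr0 add0r.
by rewrite [in LHS]e linearD linearZ/= !re -e.
Qed.

Lemma real_part_bound (M : R) : (forall z, nrm (U z) <= M * nrm z) ->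
  forall x, `|Ur x| <= M * `|x|.
Proof. by move=> h x; rewrite -[`|x|]nrm_real (le_trans (nrm_cre _)). Qed.

Lemma real_resolvent (s : R) : ~ spectrum U setT s%:C ->
  exists S : E -> E, resolvent Ur s S /\ exists c : R, forall x, `|S x| <= c * `|x|.
Proof.
move=> /contrapT[S [_ h1 h2 [c hc]]].
have reE z : cre (s%:C *: z - U z) = s *: cre z - Ur (cre z).
  by rewrite creB creZ/= scale0r subr0 real_operatorE.
exists (fun x => cre (S (Cplx x 0))); split; [split=> x|].
- have e : s%:C *: Cplx x 0 - U (Cplx x 0) = Cplx (s *: x - Ur x) 0.
    rewrite [LHS]complexification_eta reE/=; congr Cplx.
    by rewrite real_operatorE scale0r scaler0 [cim _]/= linear0 subr0 addr0.
  by rewrite -e h1.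
- by rewrite -reE h2.
- exists c => x; rewrite -[`|x|]nrm_real (le_trans (nrm_cre _))//.
  by have := hc (Cplx x 0) I; rewrite !nrmE -rmorphM lecR.
Qed.

End real_operators.

Section resolvents.
Context (R : realType) (E : banachLatticeType R).
Implicit Types (x y : E) (U V : {linear E -> E}).

Lemma resolventZ V (s : R) S a x : resolvent V s S -> S (a *: x) = a *: S x.
Proof.
move=> [h1 h2]; have Va : V (a *: S x) = a *: V (S x) by rewrite linearZ.
by rewrite -[RHS]h1 Va scalerA (mulrC s a) -scalerA -scalerBr h2.
Qed.

Lemma resolventN V (s : R) S x : resolvent V s S -> S (- x) = - S x.
Proof. by move=> hS; rewrite -scaleN1r (resolventZ _ _ hS) scaleN1r. Qed.

Lemma linear_exists (f : E -> E) : linear f ->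
  exists V : {linear E -> E}, forall x, V x = f x.
Proof.
move=> fl; pose V : {linear E -> E} := HB.pack f (GRing.isLinear.Build R E E *:%R f fl).
by exists V.
Qed.

Lemma resolvent_linear V (s : R) S : resolvent V s S -> linear S.
Proof.
move=> hS a x y; have := resolventB hS (a *: x + y) y.
by rewrite addrK (resolventZ _ _ hS) => ->; rewrite subrK.
Qed.

(** s - V = - s V (1/s - U). *)
Lemma inverse_resolvent U V (s : R) W : cancel U V -> cancel V U -> s != 0 ->
  resolvent U s^-1 W -> resolvent V s (fun x => - (s^-1 *: W (U x))).
Proof.
move=> UV VU s0 hW; have [h1 h2] := hW; split=> x.
  have -> : U (s *: x - V x) = - s *: (s^-1 *: x - U x).
    rewrite linearB linearZ/= VU scaleNr -scalerN opprB scalerBr scalerA.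
    by rewrite divff// scale1r.
  by rewrite (resolventZ _ _ hW) h1 scalerA mulrN mulVf// scaleN1r opprK.
have := congr1 V (h2 (U x)); rewrite linearB linearZ/= !UV => e.
have -> : V (- (s^-1 *: W (U x))) = - (s^-1 *: V (W (U x))).
  by rewrite linearN linearZ.
by rewrite scalerN scalerA divff// scale1r opprK addrC.
Qed.
End resolvents.

(** * Approximate point spectra *)

Section structure.
Local Open Scope complex_scope.
Context (R : realType) (E : banachLatticeType R).
Hypothesis E_complete : dedekind_complete E.
Local Notation X := (complexification E).
Local Notation C := (R[i]).
Implicit Types (x : E) (y z w : X) (P Q S : {linear E -> E}).

Lemma bounded_nrm (U : {linear X -> X}) : bounded_near U (nbhs (0 : X)) ->
  exists2 M : R, 0 <= M & forall z, nrm (U z) <= M * nrm z.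
Proof.
move=> /linear_boundedP /pinfty_ex_gt0[M M0 hM].
have ME := complexE (ltW M0).
exists (complex.Re M); first by rewrite -lecR -ME ltW.
by move=> z; have := hM z; rewrite !nrmE ME -rmorphM lecR.
Qed.

(** U x >= 0 means that the image of the negative part of x lies below that of
    the positive part; being disjoint from it, it vanishes. *)
Lemma disjoint_reflects_positive (U : {linear E -> E}) x :
  positive U -> injective U ->
  Order.meet (U (vpos x)) (U (vpos (- x))) = 0 -> 0 <= U x -> 0 <= x.
Proof.
move=> U0 Uinj dis; rewrite -{1}(vposB x) linearB vsub_ge0 => le.
have : U (vpos (- x)) = U 0 by rewrite linear0 -dis; apply/esym/meet_r.
by move=> /Uinj n0; rewrite -(vposB x) n0 subr0 vpos_ge0.
Qed.

Lemma real_automorphism (U : {linear X -> X}) : bounded_near U (nbhs (0 : X)) ->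
  disjointness_preserving U -> positive_operator U ->
  spectrum U setT `<=` [set l | `|l| = 1] ->
  exists Ur V : {linear E -> E}, [/\ forall z, U z = cplx_op Ur z,
    lattice_iso Ur V, subexponential Ur & subexponential V].
Proof.
move=> /bounded_nrm[M M0 UM] Udis Upos Uspec.
pose Ur : {linear E -> E} := real_part U.
have UE := real_operatorE Upos.
have Ur0 : positive Ur := real_part_positive Upos.
have res (s : R) : 0 <= s -> s != 1 -> exists S : E -> E, resolvent Ur s S /\
    exists c : R, forall x, `|S x| <= c * `|x|.
  move=> s0 s1; apply: real_resolvent => // /Uspec /= h; move/eqP: s1; apply.
  by move: h; rewrite ger0_norm ?ler0c// => -[].
have n01 : 0 != 1 :> R by rewrite eq_sym oner_neq0.
have [W [hW [c0 Wc]]] := res 0 (lexx 0) n01.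
have [V VE] : exists V : {linear E -> E}, forall x, V x = - W x.
  apply: linear_exists => a x y; rewrite (resolvent_linear hW) opprD scalerN.
  by [].
have UV : cancel Ur V.
  by move=> x; have := proj1 hW x; rewrite scale0r sub0r VE -(resolventN _ hW).
have VU : cancel V Ur.
  by move=> x; have := proj2 hW x; rewrite scale0r sub0r VE linearN.
have V0 : positive V.
  move=> x x0; apply: (@disjoint_reflects_positive Ur) => //; first exact: can_inj UV.
    have := Udis (Cplx (vpos (V x)) 0) (Cplx (vpos (- V x)) 0).
    rewrite /cdisjoint !UE /cplx_op/= !linear0 !modulus_real.
    rewrite !ger0_vabs ?vpos_ge0//; try by apply: Ur0; exact: vpos_ge0.
    by apply; exact: vpos_disjoint.
  by rewrite VU.
have UrM x : `|Ur x| <= M * `|x| by exact: real_part_bound.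
have VM x : `|V x| <= `|c0| * `|x|.
  rewrite VE normrN; apply: (le_trans (Wc x)).
  by rewrite ler_wpM2r// ler_norm.
exists Ur, V; split=> //.
- move=> s s1.
  have [|K K0 hK] := @positive_growth _ _ Ur M Ur0 M0 UrM _ s s1.
    by move=> r r1; apply: res; rewrite ?gt_eqF//; lra.
  by exists K => // n x; rewrite powE.
- move=> s s1.
  have [|K K0 hK] := @positive_growth _ _ V `|c0| V0 (normr_ge0 _) VM _ s s1.
    move=> r r1; have r0 : 0 < r by lra.
    have ri1 : r^-1 != 1 by rewrite invr_eq1 gt_eqF.
    have [|S [hS [c Sc]]] := res r^-1 _ ri1; first by rewrite invr_ge0 ltW.
    exists (fun x => - (r^-1 *: S (Ur x))); split.
      by apply: inverse_resolvent => //; rewrite gt_eqF.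
    exists (r^-1 * (`|c| * M)) => x.
    rewrite normrN normrZ gtr0_norm ?invr_gt0// -mulrA ler_wpM2l ?invr_ge0 ?(ltW r0)//.
    apply: (le_trans (Sc _)); apply: (@le_trans _ _ (`|c| * `|Ur x|)).
      by rewrite ler_wpM2r// ler_norm.
    by rewrite -mulrA ler_wpM2l.
  by exists K => // n x; rewrite powE.
Qed.

Definition projection_range P : set X := [set z | cplx_op P z = z].

Lemma cplx_op_compl P z : cplx_op (compl P) z = z - cplx_op P z.
Proof. by rewrite [LHS]complexification_eta [RHS]complexification_eta. Qed.

Lemma range_band P : bproj P -> band (projection_range P).
Proof.
move=> hP; have hC := bproj_compl hP; split.
- split; first by rewrite /projection_range/= linear0.
  by move=> a x y Px Py; rewrite /projection_range/= linearD linearZ/= Px Py.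
- move=> z w Pz zw; rewrite /projection_range/=.
  apply/eqP; rewrite eq_sym -subr_eq0 -cplx_op_compl; apply/eqP/modulus_eq0.
  apply/eqP; rewrite eq_le modulus_ge0 andbT modulus_bproj//.
  apply: (le_trans (bproj_le hC zw)); rewrite -modulus_bproj//.
  by rewrite cplx_op_compl Pz subrr modulus0.
- move=> B s BP [ub least].
  have PB x : B x -> P x = x by move=> /BP/(congr1 (@cre R E)).
  have PE : P s + compl P s = s by rewrite complE addrC subrK.
  have le1 : s <= P s.
    by apply: least => x Bx; rewrite -(PB x Bx) bproj_le//; exact: ub.
  (* The factor 2 serves the empty B, whose supremum lies below every
     element: together with le1 it gives s = P s in all cases. *)
  have le2 : s <= P s + (compl P s + compl P s).
    apply: least => x Bx; rewrite -(PB x Bx) -[leLHS]addr0.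
    apply: vleD2; first by rewrite bproj_le//; exact: ub.
    have := bproj_le hC (ub x Bx); rewrite [compl P x]complE (PB x Bx) subrr => h.
    exact: vaddr_ge0.
  have c0 : compl P s = 0.
    apply/eqP; rewrite eq_le; apply/andP; split.
      by move: le1; rewrite -{1}PE -[leRHS]addr0 vleDl.
    by move: le2; rewrite -{1}PE vleDl -{1}[compl P s]addr0 vleDl.
  by rewrite /projection_range/= /cplx_op/= linear0; congr Cplx; rewrite -[RHS]PE c0 addr0.
Qed.

Lemma band_projectionE P z : bproj P ->
  band_projection (projection_range P) z = cplx_op P z.
Proof.
move=> hP; have hC := bproj_compl hP; rewrite /band_projection.
have self : projection_range P (cplx_op P z) by exact: cplx_op_idem.
have dis : disjoint_complement (projection_range P) (z - cplx_op P z).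
  move=> v Pv; rewrite /cdisjoint -cplx_op_compl -Pv !modulus_bproj//.
  set m := Order.meet _ _.
  have m0 : 0 <= m by rewrite lexI !bproj_ge0 ?modulus_ge0.
  have cm : compl P m = 0.
    apply: (bproj_ideal hC (y := P (modulus v))); first by rewrite ger0_vabs// leIr.
    by rewrite complE bproj_idem// subrr.
  have pm : P m = 0.
    apply: (bproj_ideal hP (y := compl P (modulus z))); first by rewrite ger0_vabs// leIl.
    by rewrite complE linearB bproj_idem// subrr.
  by move: cm; rewrite complE pm subr0.
case: xgetP => [w _ [Pw wd]|/(_ (cplx_op P z))]; last by case.
have : projection_range P (cplx_op P (z - w)) by exact: cplx_op_idem.
move=> /wd; rewrite /cdisjoint (modulus_bproj _ hP) meet_r; last first.
  by rewrite bproj_le_id// modulus_ge0.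
rewrite -(modulus_bproj _ hP) => /modulus_eq0 /eqP.
by rewrite linearB subr_eq0 => /eqP ->.
Qed.

(** A vector y of Y close to the band of P differs little from z = P y, and F
    and G are Lipschitz. *)
Lemma localized_bounded_below_on_bands (Y : set X) (F G : X -> X) (K1 K2 c : R) :
  almost_localized Y -> {morph F : z w / z - w} -> {morph G : z w / z - w} ->
  0 <= K1 -> (forall z, nrm (F z) <= K1 * nrm z) ->
  0 <= K2 -> (forall z, nrm (G z) <= K2 * nrm z) ->
  0 <= c -> (forall y, Y y -> c * nrm (G y) <= nrm (F y)) ->
  bounded_below_on_bands c F G.
Proof.
move=> [_ _ loc] FB GB K10 FK K20 GK c0 low P hP [x Px] e e0.
have nzZ : exists2 z, projection_range P z & z != 0.
  exists (Cplx (P x) 0); first by rewrite /projection_range/= /cplx_op/= bproj_idem// linear0.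
  by apply/eqP => /(congr1 (@cre R E)).
pose L := c * K2 + K1 + 1.
have L0 : 0 < L by have := mulr_ge0 c0 K20; rewrite /L; lra.
pose d := Num.min (2^-1) (e / 2 / L).
have d0 : 0 < d by rewrite lt_min invr_gt0 ltr0n !divr_gt0.
have d2 : d <= 2^-1 by rewrite ge_min lexx.
have dL : d * L <= e / 2 by rewrite -ler_pdivlMr// ge_min lexx orbT.
have [y [Yy y1 yd]] := loc _ (range_band hP) nzZ _ d0.
rewrite band_projectionE// in yd.
pose z := cplx_op P y; pose r := y - z.
have {}y1 : nrm y = 1 by apply: (@complexI R).
have rd : nrm r <= d by rewrite ltW// -ltcR.
have zr : y - r = z by rewrite /r subKr.
have z12 : 2^-1 <= nrm z.
  by have := nrmD z r; rewrite addrC subrK y1; lra.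
exists z; split; first exact: cplx_op_idem.
  by move=> z0; move: z12; rewrite z0 /nrm modulus0 normr0; lra.
have Fz : nrm (F y) <= nrm (F z) + K1 * d.
  have -> : F y = F z + F r by rewrite -zr FB subrK.
  apply: (le_trans (nrmD _ _)); rewrite lerD2l (le_trans (FK _))//.
  by rewrite ler_wpM2l.
have Gz : nrm (G z) <= nrm (G y) + K2 * d.
  rewrite -zr GB; apply: (le_trans (nrmB _ _)); rewrite lerD2l (le_trans (GK _))//.
  by rewrite ler_wpM2l.
have := ler_wpM2l c0 Gz; have := low y Yy.
have := ler_wpM2l (ltW e0) z12.
move: dL; rewrite /L; lra.
Qed.

(** A bounded inverse gives a lower bound, so a scalar where the lower bound fails
    is automatically in the spectrum. *)
Lemma spectrum_apE (T : X -> X) (W : set X) (l : C) :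
  (forall z, W z -> W (l *: z - T z)) ->
  spectrum_ap T W l <-> ~ exists2 c : R, 0 < c &
     forall z, W z -> c * nrm z <= nrm (l *: z - T z).
Proof.
have bbE : (exists2 c : R, 0 < c & forall z, W z -> c * nrm z <= nrm (l *: z - T z)) <->
    (exists2 c : R, 0 < c & forall z, W z -> c%:C * `|z| <= `|l *: z - T z|).
  by split=> -[c c0 h]; exists c => // z /h; rewrite !nrmE -rmorphM lecR.
move=> WT; rewrite bbE; split=> [[sp nr] bb|nb]; first by apply: nr.
split; last by move=> [_].
move=> [S [_ ST _ [c Sc]]]; apply: nb.
pose k := Num.max c 1.
have k0 : 0 < k by rewrite lt_max ltr01 orbT.
exists k^-1; first by rewrite invr_gt0.
move=> z Wz; have := Sc _ (WT _ Wz); rewrite ST// !nrmE -!rmorphM !lecR => h.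
rewrite ler_pdivrMl//; apply: (le_trans h).
by rewrite ler_wpM2r ?nrm_ge0// le_max lexx.
Qed.

Lemma polyT_linearB (T : {linear X -> X}) (a : nat -> R) n :
  {morph polyT T a n : z w / z - w}.
Proof.
move=> z w; rewrite /polyT -sumrB; apply: eq_bigr => k _.
by rewrite linearB scalerBr.
Qed.

Lemma polyT_bounded (T : {linear X -> X}) (a : nat -> R) n (t : R) :
  0 <= t -> (forall z, nrm (T z) <= t * nrm z) ->
  exists2 K, 0 <= K & forall z, nrm (polyT T a n z) <= K * nrm z.
Proof.
move=> t0 Tt; exists (\sum_(k < n) `|a k| * t ^+ k).
  by apply: sumr_ge0 => k _; rewrite mulr_ge0// exprn_ge0.
move=> z; rewrite /polyT mulr_suml; elim/big_rec2: _ => [|k u v _ h].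
  by rewrite /nrm modulus0 normr0.
apply: (le_trans (nrmD _ _)); rewrite lerD// nrmZr -mulrA ler_wpM2l//.
elim: (nat_of_ord k) => [|m ih]; first by rewrite expr0 mul1r.
by rewrite powS (le_trans (Tt _))// exprS -mulrA ler_wpM2l.
Qed.

Lemma polyT_stable (T : {linear X -> X}) (Y : set X) (a : nat -> R) n y :
  linear_subspace Y -> (forall y, Y y -> Y (T y)) -> Y y -> Y (polyT T a n y).
Proof.
move=> [Y0 YD] YT Yy; rewrite /polyT; elim/big_rec: _ => // k u _ Yu.
by apply: YD => //; elim: (nat_of_ord k) => // m; exact: YT.
Qed.

Theorem bounded_below_on_localized (Y : set X) (A U : {linear X -> X})
    (l : C) (c : R) :
  almost_localized Y -> bounded_near U (nbhs (0 : X)) ->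
  disjointness_preserving U -> positive_operator U ->
  spectrum U setT `<=` [set l | `|l| = 1] -> in_center A ->
  (forall y, Y y -> Y (A (U y))) ->
  0 < c -> (forall y, Y y -> c * nrm y <= nrm (l *: y - A (U y))) ->
  exists2 c' : R, 0 < c' & forall z, c' * nrm z <= nrm (l *: z - A (U z)).
Proof.
move=> loc Ub Udis Upos Uspec [a a0 Ac] YT c0 low.
have [Ysub _ _] := loc; have [Y0 YD] := Ysub.
have [Ur [V [UE iso hU hV]]] := real_automorphism Ub Udis Upos Uspec.
have [l0|l0] := eqVneq l 0.
  pose T : {linear X -> X} := A \o U.
  have TE z : T z = A (cplx_op Ur z) by rewrite -UE.
  have nT z : nrm (l *: z - A (U z)) = nrm (T z).
    by rewrite l0 scale0r sub0r /nrm modulusN.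
  have [_ [t [_ _ _ t0 Tt]]] := operator_bounds iso hU hV a0 Ac TE.
  have sm : bounded_below_on_bands c T id.
    apply: (@localized_bounded_below_on_bands Y T id t 1 c) => //.
    - by move=> z w; rewrite linearB.
    - by move=> z; rewrite mul1r.
    - exact: ltW.
    - by move=> y Yy; rewrite -nT low.
  have [c' c'0 h] := bounded_below_weighted E_complete iso hU hV a0 Ac TE c0 sm.
  by exists c' => // z; rewrite nT.
pose A' : {linear X -> X} := l^-1 \*: A.
pose T : {linear X -> X} := A' \o U.
have TE z : T z = A' (cplx_op Ur z) by rewrite -UE.
pose b := complex.Re `|l^-1|; pose d := complex.Re `|l|.
have b0 : 0 <= b := absC_ge0 _.
have d0 : 0 < d.
  by rewrite -ltcR -complexE ?normr_ge0// normr_gt0.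
have A'c : central (b * a) A'.
  move=> z; rewrite -[A' z]/(l^-1 *: A z) modulusZ -scalerA.
  by rewrite vle_scalel.
have nT z : nrm (l *: z - A (U z)) = d * nrm (z - T z).
  rewrite -nrmZ scalerBr -[T z]/(l^-1 *: A (U z)) scalerA divff// scale1r//.
have ba0 : 0 <= b * a by rewrite mulr_ge0.
have [_ [t [_ _ _ t0 Tt]]] := operator_bounds iso hU hV ba0 A'c TE.
have YT' y : Y y -> Y (T y).
  move=> Yy; rewrite -[T y]addr0; apply: YD => //.
  exact: YT.
have cd0 : 0 < c / d by rewrite divr_gt0.
have sm q n : bounded_below_on_bands (c / d)
    (fun z => polyT T q n z - T (polyT T q n z)) (polyT T q n).
  have [K K0 hK] := polyT_bounded q n t0 Tt.
  apply: (@localized_bounded_below_on_bands Y _ _ (K + t * K) K) => //.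
  - by move=> z w; rewrite (polyT_linearB T q n) linearB !opprD addrACA.
  - exact: polyT_linearB.
  - by rewrite addr_ge0// mulr_ge0.
  - move=> z; apply: (le_trans (nrmB _ _)); rewrite mulrDl lerD//.
    by apply: (le_trans (Tt _)); rewrite -mulrA ler_wpM2l.
  - exact: ltW.
  - move=> y Yy; have := low _ (polyT_stable q n Ysub YT' Yy).
    by rewrite nT -ler_pdivrMl// mulrA (mulrC _ c).
have [c' c'0 h] := bounded_below_id_sub E_complete iso hU hV ba0 A'c TE cd0 sm.
exists (d * c'); first exact: mulr_gt0.
by move=> z; rewrite nT -mulrA ler_wpM2l// ltW.
Qed.

End structure.

Theorem theorem0p19 (R : realType) (E : banachLatticeType R)
    (E_complete : dedekind_complete E)
    (Y : set (complexification E)) (Y_loc : almost_localized Y)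
    (A U : {linear complexification E -> complexification E})
    (A_bounded : bounded_near A (nbhs (0 : complexification E)))
    (U_bounded : bounded_near U (nbhs (0 : complexification E)))
    (A_disj : disjointness_preserving A)
    (U_disj : disjointness_preserving U)
    (U_pos : positive_operator U)
    (U_spec : spectrum U setT `<=` [set l | `|l| = 1])
    (A_center : in_center A)
    (AU_Y : forall y, Y y -> Y (A (U y))) :
  spectrum_ap (A \o U) setT = spectrum_ap (A \o U) Y.
Proof.
have [[Y0 YD] _ _] := Y_loc.
have WY (l : R[i]) z : Y z -> Y (l *: z - (A \o U) z).
  move=> Yz; rewrite addrC -scaleN1r; apply: (YD); first exact: AU_Y.
  by rewrite -[_ *: z]addr0; exact: (YD).
apply/seteqP; split=> l; rewrite !spectrum_apE//=; try exact: (WY l).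
- move=> nb [c c0 low]; apply: nb.
  have [c' c'0 h] := bounded_below_on_localized E_complete Y_loc U_bounded
    U_disj U_pos U_spec A_center AU_Y c0 low.
  by exists c' => // z _; exact: h.
- by move=> nb [c c0 low]; apply: nb; exists c => // z _; exact: low.
Qed.
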